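(* Fix positive integers $d$ and $w$. For every $\epsilon>0$ there is an $N$ such that every finite convex subset $P$ of $\mathbb{N}^d$ (with the induced order) with $w(P)\in\{2,\dots,w\}$ and $|P|>N$ satisfies $\delta(P)>1/2-\epsilon$.
   Context: $\mathbb{N}$ is the set of positive integers and $\mathbb{N}^d$ carries the product (coordinatewise) order. $Q\subseteq\mathbb{N}^d$ is convex if $x,z\in Q$ and $x<y<z$ imply $y\in Q$. $w(P)$ is the width (maximum antichain size). For a uniformly random linear extension $\prec$ of $P$ and distinct $x,y\in P$, $\delta_{xy}=\min\{\mathbb{P}(x\prec y),\mathbb{P}(y\prec x)\}$, and $\delta(P)=\max\delta_{xy}$ over distinct $x,y\in P$. *)

(* Defs.v *)
From mathcomp Require Import all_boot all_order all_algebra finmap.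
From mathcomp Require Import reals.

Set Implicit Arguments.
Unset Strict Implicit.
Unset Printing Implicit Defensive.

Import Order.TTheory GRing.Theory Num.Theory.

Local Open Scope order_scope.
Local Open Scope fset_scope.

(* The mathematics takes the natural numbers to start at 1. The ambient type  *)
(* [d.-tupleprod nat] carries the coordinatewise order, so that [x < y] means *)
(* that [x] is coordinatewise at most [y] and [x] differs from [y].           *)
Definition posvec (d : nat) : pred (d.-tupleprod nat) :=
  fun x => [forall i : 'I_d, (0 < tnth x i)%N].

Section FinitePosets.
Context {disp : Order.disp_t} {T : porderType disp}.

Definition order_convex (D : pred T) (Q : {fset T}) : Prop :=
  forall x y z : T, x \in Q -> z \in Q -> D y -> x < y -> y < z -> y \in Q.

Variable P : {fset T}.

Definition antichain (A : {set P}) : bool :=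
  [forall x in A, forall y in A, (x != y) ==> (val x >< val y)].

Definition width : nat := \max_(A : {set P} | antichain A) #|A|.

(* Linear extensions are strict total orders on the elements of [P],          *)
(* represented as boolean relations that extend the induced strict order.     *)
Definition linear_extension (r : {ffun P * P -> bool}) : bool :=
  [&& [forall x, ~~ r (x, x)],
      [forall x, forall y, forall z, r (x, y) && r (y, z) ==> r (x, z)],
      [forall x, forall y, (x != y) ==> r (x, y) || r (y, x)]
    & [forall x, forall y, (val x < val y) ==> r (x, y)]].

Definition linear_extensions : {set {ffun P * P -> bool}} :=
  [set r | linear_extension r].

Variable R : realType.
Local Open Scope ring_scope.

Definition prob_before (x y : P) : R :=
  #|[set r in linear_extensions | r (x, y)]|%:R / #|linear_extensions|%:R.

Definition balance_pair (x y : P) : R :=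
  Num.min (prob_before x y) (prob_before y x).

(* The default value 0 matters only when [P] has fewer than two elements:     *)
(* all the quantities being maximized are nonnegative.                        *)
Definition balance : R :=
  \big[Num.max/0]_(xy : P * P | xy.1 != xy.2) balance_pair xy.1 xy.2.

End FinitePosets.

(* Main.v *)
Require Import Defs.
From mathcomp Require Import all_boot all_order all_algebra finmap.
From mathcomp Require Import reals.
From mathcomp Require Import boolp ring lra zify.

(* Let A be a longest row x, x + e_k, ..., x + (m-1) e_k that is down-closed  *)
(* in P, and B a longest such row of the convex set P \ A. As antichains are  *)
(* bounded, |P| = O(|A|) and |P \ A| = O(|B|). Once the order of P \ A is     *)
(* fixed, a linear extension amounts to the number of elements of A in each   *)
(* gap of that order, and moving one element of A to an earlier gap always    *)
(* gives a linear extension again. Double counting such moves shows that the  *)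
(* proportion of nonempty gaps can hardly increase from one window of         *)
(* consecutive gaps to the next. It lies in [0, 1], so it is almost constant  *)
(* around most elements b of an initial segment of B, and then moving several *)
(* elements of A across b costs only a constant factor: every position of b   *)
(* relative to A has small probability. Moving elements of B instead shows    *)
(* that b typically precedes the last elements of A. Hence the probability    *)
(* that a precedes b passes 1/2 in small steps as a runs through A. If P \ A  *)
(* has bounded size, the first element of B already works.                    *)

(** Suppose that no element of A forms a balanced pair with b. Then the probability that the i-th
    element of A precedes b jumps across the interval around 1/2 in one step, so the number of
    elements of A before b takes a single value phi with probability at least 2 eps
    ([median_level]); [late_chain_rare] puts phi into the first three quarters of A. For T elements
    b that lie far apart in B this contradicts [levels_rare], by which such values have average
    probability at most eps.

    For [levels_rare], the gaps are cut into windows that end at the chosen b. Moves from one window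
    to the one before it show that the density of nonempty gaps rarely jumps up ([density_jump]) and
    is rarely low ([low_density_small]). Where it is neither low nor falling, moves across b hardly
    shrink the set of states, so the values phi, phi + 1, ..., phi + s - 1 are of comparable weight
    and phi has probability at most 2/s ([level_small]). Falls of the density are few because it
    stays in [0, 1] ([sum_level_le]).

    Convexity and dimension enter only through [size_le_ideal_rows], which makes the rows long, and
    [rows_le], which controls the relations between them; [balanced_of_chains] is the interface. *)

Set Implicit Arguments.
Unset Strict Implicit.
Unset Printing Implicit Defensive.
Import Order.TTheory GRing.Theory Num.Theory.
Local Open Scope ring_scope.

(** * Moving one element between gaps *)

Section GapSystems.
Variables (R : realFieldType) (Omega : finType) (gap : Omega -> nat -> nat).

(* [gap om k] counts the elements of a chain in the [k]-th gap of the state     *)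
(* [om]; here [om'] arises from [om] by moving one of them from gap [q] to gap  *)
(* [p].                                                                         *)
Definition transfers (p q : nat) (om om' : Omega) : Prop :=
  forall k, (gap om' k + (k == q) = gap om k + (k == p))%N.

Definition gap_inj (S : {set Omega}) : Prop :=
  {in S &, forall om om', gap om =1 gap om' -> om = om'}.

Lemma gap_injS (S E : {set Omega}) : E \subset S -> gap_inj S -> gap_inj E.
Proof. by move=> /subsetP sub inj x y /sub xS /sub yS; apply: inj. Qed.

Lemma ler_sum_sub (D D' : {set Omega}) (f : Omega -> R) :
  D \subset D' -> (forall om, om \in D' -> 0 <= f om) ->
  \sum_(om in D) f om <= \sum_(om in D') f om.
Proof.
move=> sub f0; rewrite [leRHS](big_setID D) /= (setIidPr sub) lerDl.
by apply: sumr_ge0 => om; rewrite inE => /andP[_]; apply: f0.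
Qed.

(** For fixed [p] and [q] the move can be undone on the gap sizes, and these determine the state, so
    moving is injective. *)
Lemma transfer_count (E E' : {set Omega}) (p q : nat) (f f' : Omega -> R) :
  gap_inj E -> p != q ->
  (forall om, om \in E -> (0 < gap om q)%N ->
     exists2 om', om' \in E' & transfers p q om om') ->
  (forall om', om' \in E' -> 0 <= f' om') ->
  (forall om om', om \in E -> om' \in E' -> (0 < gap om q)%N ->
     transfers p q om om' -> f om <= f' om') ->
  \sum_(om in E | (0 < gap om q)%N) f om
    <= \sum_(om in E' | (0 < gap om p)%N) f' om.
Proof.
move=> injE npq mv f'0 ff'.
pose D := [set om in E | (0 < gap om q)%N].
pose D' := [set om in E' | (0 < gap om p)%N].
have sumD F : \sum_(om in E | (0 < gap om q)%N) F om = \sum_(om in D) F om :> R.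
  by apply: eq_bigl => om; rewrite inE.
have sumD' F : \sum_(om in E' | (0 < gap om p)%N) F om = \sum_(om in D') F om :> R.
  by apply: eq_bigl => om; rewrite inE.
have /choice[h hP] om : exists om', om \in D -> om' \in E' /\ transfers p q om om'.
  have [|nD] := boolP (om \in D); last by exists om.
  by rewrite inE => /andP[oE gq]; have [om' ? ?] := mv _ oE gq; exists om'.
have hD' om : om \in D -> h om \in D'.
  move=> oD; have [hE ht] := hP om oD; rewrite inE hE /=.
  by have := ht p; rewrite eqxx (negbTE npq); lia.
have hinj : {in D &, injective h}.
  move=> x y xD yD hxy; have [_ tx] := hP x xD; have [_ ty] := hP y yD.
  move: xD yD; rewrite !inE => /andP[xE _] /andP[yE _].
  apply: injE => // k; have := tx k; have := ty k; rewrite hxy; lia.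
rewrite sumD sumD'; apply: (@le_trans _ _ (\sum_(om in D) f' (h om))).
  apply: ler_sum => om oD; have [hE ht] := hP om oD.
  by move: (oD); rewrite inE => /andP[oE gq]; apply: ff'.
rewrite -(big_imset _ hinj) /=; apply: ler_sum_sub.
  by apply/subsetP => _ /imsetP[om oD ->]; apply: hD'.
by move=> om; rewrite inE => /andP[/f'0].
Qed.


(** The function [v] weighs the source gap: an indicator counts gaps, the identity counts chain
    elements. The source has one element fewer after the move, whence the successor on the right. *)
Lemma transfer_double_count (E E' : {set Omega}) (Ps Qs : seq nat) (w w' : Omega -> R)
    (v : nat -> R) :
  gap_inj E -> {in Ps & Qs, forall p q, p != q} -> v 0%N = 0 ->
  (forall n, 0 <= v n) ->
  (forall om p q, om \in E -> p \in Ps -> q \in Qs -> (0 < gap om q)%N ->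
     exists2 om', om' \in E' & transfers p q om om') ->
  (forall om', om' \in E' -> 0 <= w' om') ->
  (forall om om' p q, om \in E -> om' \in E' -> p \in Ps -> q \in Qs ->
     (0 < gap om q)%N -> transfers p q om om' -> w om <= w' om') ->
  \sum_(om in E) w om * ((size Ps)%:R * \sum_(q <- Qs) v (gap om q))
    <= \sum_(om in E') w' om * ((\sum_(p <- Ps) (0 < gap om p))%:R
                                * \sum_(q <- Qs) v (gap om q).+1).
Proof.
move=> injE npq v0 v_ge0 mv w'0 ww'.
have -> : \sum_(om in E) w om * ((size Ps)%:R * \sum_(q <- Qs) v (gap om q))
    = \sum_(p <- Ps) \sum_(q <- Qs)
        \sum_(om in E | (0 < gap om q)%N) w om * v (gap om q).
  rewrite [RHS](eq_bigr (fun=> \sum_(om in E) w om * \sum_(q <- Qs) v (gap om q))).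
    rewrite big_const_seq count_predT iter_addr_0 -sumrMnl; apply: eq_bigr => om _.
    by rewrite mulrCA mulr_natl.
  move=> p _; under [RHS]eq_bigr do rewrite mulr_sumr.
  rewrite [RHS]exchange_big /=; apply: eq_bigr => q _.
  rewrite [RHS](bigID (fun om => (0 < gap om q)%N)) /= [X in _ + X]big1 ?addr0//.
  by move=> om /andP[_]; rewrite lt0n negbK => /eqP ->; rewrite v0 mulr0.
have -> : \sum_(om in E') w' om * ((\sum_(p <- Ps) (0 < gap om p))%:R
                                * \sum_(q <- Qs) v (gap om q).+1)
    = \sum_(p <- Ps) \sum_(q <- Qs)
        \sum_(om in E' | (0 < gap om p)%N) w' om * v (gap om q).+1.
  under eq_bigr do rewrite natr_sum mulr_suml mulr_sumr.
  rewrite exchange_big /=; apply: eq_bigr => p _.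
  rewrite exchange_big /= [RHS]big_mkcondr; apply: eq_bigr => om _.
  by case: ifP => _; rewrite ?mul0r ?mulr0 // mul1r mulr_sumr.
rewrite big_seq [leRHS]big_seq; apply: ler_sum => p pP.
rewrite big_seq [leRHS]big_seq; apply: ler_sum => q qQ.
apply: transfer_count => //; first exact: npq.
- by move=> om oE gq; apply: mv.
- by move=> om' oE'; rewrite mulr_ge0 ?w'0.
move=> om om' oE oE' gq tr; have := tr q; rewrite eqxx eq_sym (negbTE (npq _ _ pP qQ)).
rewrite addn0 addn1 => ->; rewrite ler_wpM2r //.
exact: (ww' _ _ p q).
Qed.

(** For linear extensions this is the position of an outside element relative to the chain, see
    [level_rank]. *)
Definition level (om : Omega) (k : nat) : nat := \sum_(0 <= i < k) gap om i.

Definition nonempty_gaps (om : Omega) (u v : nat) : nat :=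
  \sum_(u <= i < v) (0 < gap om i)%N.

Lemma sum_eq_index (u v p : nat) : (\sum_(u <= i < v) (i == p) = (u <= p < v))%N.
Proof.
elim: v => [|v IH]; first by rewrite big_geq //; lia.
case: (leqP u v) => uv; last by rewrite big_geq //; lia.
by rewrite big_nat_recr //= IH; lia.
Qed.

Lemma transfers_nonempty (om om' : Omega) (p q u v : nat) :
  transfers p q om om' ->
  (nonempty_gaps om u v <= nonempty_gaps om' u v + (u <= q < v)
   /\ nonempty_gaps om' u v <= nonempty_gaps om u v + (u <= p < v))%N.
Proof.
move=> tr; rewrite -!sum_eq_index /nonempty_gaps -!big_split /=.
by split; apply: leq_sum => i _; have := tr i; lia.
Qed.

Lemma transfers_sum (om om' : Omega) (p q u v : nat) :
  transfers p q om om' ->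
  (\sum_(u <= i < v) gap om' i + (u <= q < v)
   = \sum_(u <= i < v) gap om i + (u <= p < v))%N.
Proof.
move=> tr; rewrite -!sum_eq_index -!big_split /=.
by apply: eq_bigr => i _; apply: tr.
Qed.

Definition density (om : Omega) (u v : nat) : R :=
  (nonempty_gaps om u v)%:R / (v - u)%:R.

Lemma nonempty_gaps_le (om : Omega) (u v : nat) : (nonempty_gaps om u v <= v - u)%N.
Proof.
rewrite -[(v - u)%N]muln1 -sum_nat_const_nat; apply: leq_sum => i _; lia.
Qed.

Lemma density_ge0 (om : Omega) (u v : nat) : 0 <= density om u v.
Proof. by rewrite divr_ge0 ?ler0n. Qed.

Lemma density_le1 (om : Omega) (u v : nat) : density om u v <= 1.
Proof.
have [vu|uv] := leqP v u.
  by rewrite /density (_ : v - u = 0)%N ?invr0 ?mulr0 //; lia.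
by rewrite ler_pdivrMr ?mul1r ?ler_nat ?nonempty_gaps_le // ltr0n subn_gt0.
Qed.

(** The weight [w] spreads mass one over the moves out of a state of [E]: there are [v - u] targets
    and [nonempty_gaps om v z] sources. The mass that enters a state of [E'] is at most the ratio of
    its left density to its right density, hence at most [lam]. *)
Lemma one_step (S E E' : {set Omega}) (u v z : nat) (lam : R) :
  gap_inj S -> E \subset S -> (u < v)%N -> (v < z)%N ->
  (forall om, om \in E -> 0 < density om v z) ->
  (forall om p q, om \in E -> (u <= p < v)%N -> (v <= q < z)%N ->
     (0 < gap om q)%N -> exists2 om', om' \in E' & transfers p q om om') ->
  (forall om', om' \in E' ->
     0 < density om' v z /\ density om' u v <= lam * density om' v z) ->
  #|E|%:R <= lam * #|E'|%:R.
Proof.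
move=> injS ES uv vz dE mv dE'.
pose w om := ((v - u)%:R * (nonempty_gaps om v z)%:R)^-1 : R.
have vu0 : 0 < (v - u)%:R :> R by rewrite ltr0n subn_gt0.
have zv0 : 0 < (z - v)%:R :> R by rewrite ltr0n subn_gt0.
have ne0 om : 0 < density om v z -> 0 < (nonempty_gaps om v z)%:R :> R.
  by rewrite /density pmulr_lgt0 // invr_gt0.
have w0 om : 0 <= w om by rewrite invr_ge0 mulr_ge0 ?ler0n.
unshelve epose proof (@transfer_double_count E E' (index_iota u v) (index_iota v z) w w
  (fun n => (0 < n)%N%:R) (gap_injS ES injS) _ _ _ _ _ _) as le1 => //.
- by move=> p q; rewrite !mem_index_iota => /andP[_ pv] /andP[vq _]; apply/eqP; lia.
- by move=> om p q oE; rewrite !mem_index_iota => pI qI; apply: mv.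
- move=> om om' p q oE oE'; rewrite !mem_index_iota => pI qI gq tr.
  have n0 := ne0 _ (dE _ oE); have n0' := ne0 _ (proj1 (dE' _ oE')).
  rewrite /w lef_pV2 ?posrE ?mulr_gt0 // ler_wpM2l ?(ltW vu0) // ler_nat.
  have [_] := transfers_nonempty v z tr.
  by rewrite (_ : (v <= p < z)%N = false) ?addn0 //; lia.
rewrite size_iota in le1.
have -> : #|E|%:R = \sum_(om in E) w om * ((v - u)%:R *
    \sum_(q <- index_iota v z) (0 < gap om q)%N%:R) :> R.
  rewrite -sum1_card natr_sum; apply: eq_bigr => om oE.
  by rewrite -natr_sum mulVf // mulf_neq0 // lt0r_neq0 // ne0 // dE.
apply: le_trans le1 _; rewrite -sum1_card natr_sum mulr_sumr; apply: ler_sum => om oE'.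
have [d0 dle] := dE' _ oE'; rewrite mulr1.
rewrite -ler_pdivrMr // in dle.
apply: le_trans dle; rewrite big_const_seq count_predT size_iota iter_addr_0.
rewrite /w /density /nonempty_gaps le_eqVlt; apply/orP; left; apply/eqP.
have := ne0 _ d0; rewrite /nonempty_gaps => n0.
by field; rewrite !gt_eqF.
Qed.

Lemma transfers_density (om om' : Omega) (p q u v z W : nat) :
  (0 < W)%N -> (u + W <= v)%N -> (v + W <= z)%N -> (u <= p < v)%N -> (v <= q < z)%N ->
  transfers p q om om' ->
  [/\ density om' u v <= density om u v + W%:R^-1,
      density om u v <= density om' u v &
      density om v z <= density om' v z + W%:R^-1].
Proof.
move=> W0 uv vz pI qI tr.
have hW0 : 0 < W%:R :> R by rewrite ltr0n.
have hu : W%:R <= (v - u)%:R :> R by rewrite ler_nat; lia.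
have hv : W%:R <= (z - v)%:R :> R by rewrite ler_nat; lia.
have [h1 h2] := transfers_nonempty u v tr.
have [h3 _] := transfers_nonempty v z tr.
have iu : (v - u)%:R^-1 <= W%:R^-1 :> R by rewrite lef_pV2 // posrE; apply: lt_le_trans hu.
have iv : (z - v)%:R^-1 <= W%:R^-1 :> R by rewrite lef_pV2 // posrE; apply: lt_le_trans hv.
have u0 : 0 <= (v - u)%:R^-1 :> R by rewrite invr_ge0.
have v0 : 0 <= (z - v)%:R^-1 :> R by rewrite invr_ge0.
split; rewrite /density.
- apply: le_trans (lerD (lexx _) iu); rewrite -[X in _ + X]mul1r -mulrDl.
  by rewrite ler_wpM2r // natr1 ler_nat; lia.
- by rewrite ler_wpM2r // ler_nat; lia.
- apply: le_trans (lerD (lexx _) iv); rewrite -[X in _ + X]mul1r -mulrDl.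
  by rewrite ler_wpM2r // natr1 ler_nat; lia.
Qed.

Lemma transfers_level om om' p q (u v z : nat) : (u <= p < v)%N -> (v <= q < z)%N ->
  transfers p q om om' -> level om' v = (level om v).+1.
Proof. by move=> pI qI tr; have := transfers_sum 0 v tr; rewrite -!/(level _ _); lia. Qed.

(* Bernoulli gives |U 0| <= 2 |U j| for j < s, and the U j are disjoint. *)
Lemma slow_decay_small (U : nat -> {set Omega}) (S : {set Omega}) (v s phi : nat) (mu : R) :
  (0 < s)%N -> 0 <= mu <= 1 -> s%:R * mu <= 1 / 2 ->
  (forall j, U j \subset [set om in S | level om v == (phi + j)%N]) ->
  (forall j, (j < s)%N -> (1 - mu) * #|U j|%:R <= #|U j.+1|%:R) ->
  #|U 0%N|%:R <= 2 / s%:R * #|S|%:R :> R.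
Proof.
move=> s0 /andP[mu0 mu1] mus US step.
have hs0 : 0 < s%:R :> R by rewrite ltr0n.
have bern j : 1 - j%:R * mu <= (1 - mu) ^+ j.
  elim: j => [|j IH]; first by rewrite mul0r subr0.
  rewrite exprSr -natr1; have : 0 <= j%:R :> R by []; nra.
have iter_step j : (j <= s)%N -> (1 - mu) ^+ j * #|U 0%N|%:R <= #|U j|%:R :> R.
  elim: j => [|j IH] js; first by rewrite mul1r.
  apply: le_trans (step _ js); rewrite exprS -mulrA ler_wpM2l ?IH ?(ltnW js) //; lra.
have half j : (j < s)%N -> #|U 0%N|%:R <= 2 * #|U j|%:R :> R.
  move=> js; have := iter_step j (ltnW js); have := bern j.
  have : j%:R * mu <= s%:R * mu by rewrite ler_wpM2r // ler_nat ltnW.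
  have : 0 <= #|U 0%N|%:R :> R by []; nra.
have disj : (\sum_(j < s) #|U j| <= #|S|)%N.
  rewrite -sum1_card.
  rewrite (eq_bigr (fun j : 'I_s => \sum_(om in S) (om \in U j))%N); last first.
    move=> j _; rewrite -sum1_card big_mkcond [RHS]big_mkcond; apply: eq_bigr => om _.
    case: (boolP (om \in U j)) => oU; last by case: ifP.
    by have := subsetP (US j) _ oU; rewrite inE => /andP[->].
  rewrite exchange_big /=; apply: leq_sum => om oS.
  apply: (@leq_trans (\sum_(j < s) ((j : nat) == level om v - phi)))%N.
    apply: leq_sum => j _; case: (boolP (om \in U j)) => // oU.
    by have := subsetP (US j) _ oU; rewrite inE => /andP[_ /eqP ->]; rewrite addKn eqxx.
  by rewrite -(big_mkord xpredT (fun j => (j == _) : nat)) sum_eq_index leq_b1.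
rewrite mulrAC ler_pdivlMr //.
apply: (@le_trans _ _ (\sum_(j < s) 2 * #|U j|%:R)).
  rewrite mulr_natr -[X in _ *+ X](card_ord s) -sumr_const; apply: ler_sum => j _.
  exact: half.
by rewrite -mulr_sumr -natr_sum ler_pM2l ?ltr0n // ler_nat.
Qed.

(** * Systems closed under moves to an earlier gap *)

Section UpClosed.
Variables (S : {set Omega}) (top m : nat).
Hypothesis gap_total : forall om, om \in S -> level om top.+1 = m.
Hypothesis injS : gap_inj S.
Hypothesis transferS : forall om p q, om \in S -> (p < q <= top)%N ->
  (0 < gap om q)%N -> exists2 om', om' \in S & transfers p q om om'.

Lemma transfer_window (u v z : nat) om p q : (z <= top.+1)%N -> om \in S ->
  (u <= p < v)%N -> (v <= q < z)%N -> (0 < gap om q)%N ->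
  exists2 om', om' \in S & transfers p q om om'.
Proof. by move=> ztop oS pI qI; apply: transferS => //; lia. Qed.

(* A move from the right window to the left one gains a factor density(right) /  *)
(* density(left), so repeated moves show that the density rarely jumps up.      *)
Lemma density_jump (u v z W s : nat) (a : R) :
  (0 < W)%N -> (u + W <= v)%N -> (v + W <= z)%N -> (z <= top.+1)%N ->
  0 < a <= 1 -> 4 * s%:R <= a * W%:R ->
  #|[set om in S | density om u v + a <= density om v z]|%:R
    <= (1 - a / 2) ^+ s * #|S|%:R.
Proof.
move=> W0 uv vz ztop /andP[a0 a1] saW.
have uv' : (u < v)%N by lia.
have vz' : (v < z)%N by lia.
have hW0 : 0 < W%:R :> R by rewrite ltr0n.
(* A move costs at most [1 / W] in each of the two densities; after [s] moves at least [a / 2] of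
   the difference [a] is left. *)
pose t j := 2 * j%:R / W%:R : R.
pose U j := [set om in S | density om u v + a - t j <= density om v z].
have tle j : (j <= s)%N -> t j <= a / 2.
  move=> js; have : j%:R <= s%:R :> R by rewrite ler_nat.
  by rewrite /t ler_pdivrMr //; lra.
have tS j : t j.+1 = t j + 2 * W%:R^-1 by rewrite /t -natr1; field; rewrite gt_eqF.
have step j : (j < s)%N -> #|U j|%:R <= (1 - a / 2) * #|U j.+1|%:R :> R.
  move=> js; have tj := tle _ js; have tj' := tle _ (ltnW js).
  apply: (@one_step S _ _ u v z) => //.
  - by apply/subsetP => om; rewrite inE => /andP[].
  - by move=> om; rewrite inE => /andP[_]; have := density_ge0 om u v; lra.
  - move=> om p q; rewrite inE => /andP[oS dom] pI qI gq.
    have [om' oS' tr] := transfer_window ztop oS pI qI gq.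
    exists om' => //; rewrite inE oS' /=.
    have [] := transfers_density W0 uv vz pI qI tr; rewrite tS; lra.
  move=> om; rewrite inE => /andP[_]; have := density_ge0 om u v.
  have := density_le1 om v z; split; first lra.
  nra.
have iter_step j : (j <= s)%N -> #|U 0%N|%:R <= (1 - a / 2) ^+ j * #|U j|%:R :> R.
  elim: j => [|j IH] js; first by rewrite mul1r.
  apply: le_trans (IH (ltnW js)) _; rewrite exprSr -mulrA ler_wpM2l ?step //.
  by apply: exprn_ge0; lra.
have -> : [set om in S | density om u v + a <= density om v z] = U 0%N.
  by apply/setP => om; rewrite !inE /t mulr0 mul0r subr0.
apply: le_trans (iter_step s (leqnn s)) _; rewrite ler_wpM2l ?exprn_ge0 //; first lra.
by rewrite ler_nat subset_leq_card //; apply/subsetP => om; rewrite inE => /andP[].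
Qed.

(** After [j] moves across the boundary [v] the level is [phi + j], and the right density falls
    short of the left one by at most [x + 2 * j / W]. By the hypothesis on [x] the ratio of right to
    left stays at least [1 - mu] with [mu = 1 / (2 * s)], so [slow_decay_small] applies. *)
Lemma level_small (u v z W s phi : nat) (th x : R) :
  (0 < W)%N -> (u + W <= v)%N -> (v + W <= z)%N -> (z <= top.+1)%N ->
  (0 < s)%N -> 0 < th -> x + 2 * s%:R / W%:R <= th / (2 * s%:R) ->
  #|[set om in S | [&& level om v == phi, th <= density om u v
        & density om u v - x <= density om v z]]|%:R
    <= 2 / s%:R * #|S|%:R :> R.
Proof.
move=> W0 uv vz ztop s0 th0 xth.
have uv' : (u < v)%N by lia.
have vz' : (v < z)%N by lia.
have hW0 : 0 < W%:R :> R by rewrite ltr0n.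
have hs0 : 0 < s%:R :> R by rewrite ltr0n.
pose t j := 2 * j%:R / W%:R : R.
pose U j := [set om in S | [&& level om v == (phi + j)%N,
   th <= density om u v & density om u v - x - t j <= density om v z]].
have tle j : (j <= s)%N -> x + t j <= th / (2 * s%:R).
  by move=> js; apply: le_trans xth; rewrite lerD2l ler_pM2r ?invr_gt0 // ler_pM2l // ler_nat.
have tS j : t j.+1 = t j + 2 * W%:R^-1 by rewrite /t -natr1; field; rewrite gt_eqF.
pose mu : R := (2 * s%:R)^-1.
have s1 : 1 <= s%:R :> R by rewrite ler1n.
have mu0 : 0 < mu by rewrite invr_gt0; lra.
have mus : s%:R * mu = 2^-1 by rewrite /mu; field; rewrite gt_eqF.
have mu1 : mu <= 1 / 2 by nra.
have step j : (j < s)%N -> #|U j|%:R <= (1 - mu)^-1 * #|U j.+1|%:R :> R.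
  move=> js; have tj := tle _ js; have tj' := tle _ (ltnW js).
  have sub k om : om \in U k -> (k <= s)%N ->
      (1 - mu) * density om u v <= density om v z /\ 0 < density om v z.
    rewrite inE => /andP[_ /and3P[_ dth dx]] /tle; rewrite -/mu => tk.
    have : th * mu <= density om u v * mu by rewrite ler_pM2r.
    move=> ?; have : (1 - mu) * density om u v <= density om v z by lra.
    split=> //; nra.
  apply: (@one_step S _ _ u v z) => //.
  - by apply/subsetP => om; rewrite inE => /andP[].
  - by move=> om oU; have [] := sub _ _ oU (ltnW js).
  - move=> om p q; rewrite inE => /andP[oS /and3P[/eqP op dth dom]] pI qI gq.
    have [om' oS' tr] := transfer_window ztop oS pI qI gq.
    exists om' => //; rewrite inE oS' /=.
    apply/and3P; split; first by rewrite (transfers_level pI qI tr) op addnS.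
      by have [] := transfers_density W0 uv vz pI qI tr; lra.
    have [] := transfers_density W0 uv vz pI qI tr; rewrite tS; lra.
  move=> om oU; have [h1 h2] := sub _ _ oU js; split=> //.
  by rewrite -ler_pdivrMl ?invr_gt0 ?invrK //; lra.
have := @slow_decay_small U S v s phi mu s0.
rewrite mus mul1r lexx; have -> : 0 <= mu <= 1 by apply/andP; split; lra.
have -> : [set om in S | [&& level om v == phi, th <= density om u v
        & density om u v - x <= density om v z]] = U 0%N.
  by apply/setP => om; rewrite !inE /t mulr0 mul0r subr0 addn0.
apply=> // [j|j js].
  by apply/subsetP => om; rewrite !inE => /andP[-> /and3P[->]].
by have := step _ js; rewrite ler_pdivlMl //; lra.
Qed.

(** Here chain elements are counted instead of gaps. At least a quarter of the chain lies beyond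
    [v], and each of these elements can move to every gap of the left window, whereas an image has
    few nonempty gaps there that could have received it. *)
Lemma low_density_small (u v W phi : nat) (th : R) (C : nat) :
  (0 < W)%N -> (u + W <= v)%N -> (v <= top)%N -> 0 <= th ->
  (4 * phi <= 3 * m)%N -> (m + top < C * m)%N ->
  #|[set om in S | (level om v == phi) && (density om u v < th)]|%:R
    <= 4 * C%:R * (th + W%:R^-1) * #|S|%:R :> R.
Proof.
move=> W0 uv vtop th0 phim mtop.
have split_level om : (level om top.+1 = level om v + \sum_(v <= i < top.+1) gap om i)%N.
  by rewrite /level (@big_cat_nat _ _ _ v) //=; lia.
have hW0 : 0 < W%:R :> R by rewrite ltr0n.
set E := [set om in S | _].
have ES : E \subset S by apply/subsetP => om; rewrite inE => /andP[].
have hL0 : 0 < (v - u)%:R :> R by rewrite ltr0n; lia.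
have iL : (v - u)%:R^-1 <= W%:R^-1 :> R.
  by rewrite lef_pV2 ?posrE // ler_nat; lia.
(* The summand 1 allows for the gap that the move itself may fill. *)
pose E' := [set om in S | (nonempty_gaps om u v)%:R <= th * (v - u)%:R + 1].
unshelve epose proof (@transfer_double_count E E' (index_iota u v) (index_iota v top.+1)
  (fun=> 1) (fun=> 1) (fun n => n%:R) (gap_injS ES injS) _ _ _ _ _ _) as le1 => //.
- by move=> p q; rewrite !mem_index_iota => /andP[_ pv] /andP[vq _]; apply/eqP; lia.
- move=> om p q; rewrite inE !mem_index_iota => /and3P[oS _ dom] pI qI gq.
  have [|om' oS' tr] := @transferS om p q oS _ gq; first lia.
  exists om' => //; rewrite inE oS' /=.
  have [_ h2] := transfers_nonempty u v tr.
  have h3 : (nonempty_gaps om' u v)%:R <= (nonempty_gaps om u v)%:R + 1 :> R.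
    by rewrite natr1 ler_nat; lia.
  by move: dom; rewrite /density ltr_pdivrMr // => dom; lra.
have {le1} le2 : \sum_(om in E) (v - u)%:R * (m - phi)%:R
    <= \sum_(om in E') (th * (v - u)%:R + 1) * (m + top.+1)%:R.
  apply: le_trans (le_trans le1 _).
    apply: ler_sum => om; rewrite inE => /and3P[oS /eqP op _].
    rewrite mul1r size_iota ler_pM2l // -natr_sum ler_nat -(gap_total oS).
    by rewrite split_level op addKn.
  apply: ler_sum => om; rewrite inE => /andP[oS dom]; rewrite mul1r.
  apply: ler_pM => //; rewrite ?sumr_ge0 // -natr_sum ler_nat -(gap_total oS).
  under eq_bigr do rewrite -addn1.
  rewrite big_split /= sum_nat_const_nat.
  by rewrite split_level muln1 leq_add ?leq_addl ?leq_subr.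
move: le2; rewrite !sumr_const -[leLHS]mulr_natr -[leRHS]mulr_natr => le2.
have cE : #|E'|%:R <= #|S|%:R :> R.
  by rewrite ler_nat subset_leq_card //; apply/subsetP => om; rewrite inE => /andP[].
have mphi : m%:R <= 4 * (m - phi)%:R :> R by rewrite -natrM ler_nat; lia.
have mC : (m + top.+1)%:R <= C%:R * m%:R :> R by rewrite -natrM ler_nat; lia.
have m0 : 0 < m%:R :> R by rewrite ltr0n; lia.
have thL : 0 < th * (v - u)%:R + 1 by rewrite ltr_wpDl ?mulr_ge0.
rewrite -(ler_pM2l hL0) -(ler_pM2r m0).
apply: le_trans (_ : 4 * ((v - u)%:R * (m - phi)%:R * #|E|%:R) <= _).
  rewrite [leRHS](_ : _ = (v - u)%:R * #|E|%:R * (4 * (m - phi)%:R)); last by ring.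
  by rewrite ler_wpM2l // mulr_ge0 // ltW.
apply: le_trans (_ : 4 * ((th * (v - u)%:R + 1) * (C%:R * m%:R) * #|S|%:R) <= _).
  rewrite ler_pM2l // (le_trans le2) //; apply: ler_pM => //.
    by rewrite mulr_ge0 // ltW.
  by rewrite ler_pM2l.
have : th * (v - u)%:R + 1 <= (v - u)%:R * (th + W%:R^-1).
  have := ler_wpM2l (ltW hL0) iL; rewrite divff ?lt0r_neq0 //; lra.
have cS : 0 <= C%:R * m%:R * #|S|%:R :> R by rewrite !mulr_ge0.
by move=> /(ler_wpM2l cS); lra.
Qed.
(** If the chain is long compared with the number of gaps, the single target [k] suffices: counted
    by elements, a state of [U j] has [m - phi - j] moves out and a state of [U j.+1] at most
    [m - phi - j + top] moves in. *)
Lemma level_small_few_gaps (k s phi : nat) :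
  (0 < s)%N -> (k < top)%N -> (4 * phi <= 3 * m)%N -> (4 * s * (2 * top + 1) <= m)%N ->
  #|[set om in S | level om k.+1 == phi]|%:R <= 2 / s%:R * #|S|%:R :> R.
Proof.
move=> s0 ktop phim sm.
pose U j := [set om in S | level om k.+1 == (phi + j)%N].
have split_level om : (level om top.+1 = level om k.+1 + \sum_(k.+1 <= i < top.+1) gap om i)%N.
  by rewrite /level (@big_cat_nat _ _ _ k.+1) //=; lia.
have -> : [set om in S | level om k.+1 == phi] = U 0%N.
  by apply/setP => om; rewrite !inE addn0.
have n0 : (2 * (s * top) <= m - phi - s)%N by nia.
have n1 : (0 < m - phi - s)%N by nia.
have d0 : 0 < (m - phi - s)%:R :> R by rewrite ltr0n.
have st : 2 * (s%:R * top%:R) <= (m - phi - s)%:R :> R by rewrite -!natrM ler_nat.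
have s1 : 1 <= s%:R :> R by rewrite ler1n.
have t0 : 0 <= top%:R :> R by [].
apply: (@slow_decay_small U S k.+1 s phi (top%:R / (m - phi - s)%:R)) => //.
- apply/andP; split; first by rewrite divr_ge0.
  by rewrite ler_pdivrMr //; nra.
- by rewrite mulrA ler_pdivrMr //; lra.
move=> j js.
have US i : U i \subset S by apply/subsetP => om; rewrite inE => /andP[].
unshelve epose proof (@transfer_double_count (U j) (U j.+1) [:: k] (index_iota k.+1 top.+1)
  (fun=> 1) (fun=> 1) (fun n => n%:R) (gap_injS (US j) injS) _ _ _ _ _ _) as le1 => //.
- by move=> p q; rewrite inE mem_index_iota => /eqP-> /andP[vq _]; apply/eqP; lia.
- move=> om p q; rewrite !inE mem_index_iota => /andP[oS /eqP dom] /eqP-> qI gq.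
  have kI : (k <= k < k.+1)%N by rewrite leqnn /=.
  have [om' oS' tr] := transfer_window (leqnn _) oS kI qI gq.
  by exists om' => //; rewrite inE oS' /= (transfers_level kI qI tr) dom addnS.
have mj : (m - phi - s <= m - phi - j)%N by lia.
have le2 : (m - phi - j)%:R * #|U j|%:R <= (m - phi - j + top)%:R * #|U j.+1|%:R :> R.
  apply: le_trans (le_trans le1 _).
    rewrite mulr_natr -sumr_const; apply: ler_sum => om; rewrite inE => /andP[oS /eqP op].
    rewrite !mul1r -natr_sum ler_nat -(gap_total oS) split_level op; lia.
  rewrite mulr_natr -sumr_const; apply: ler_sum => om; rewrite inE => /andP[oS /eqP op].
  rewrite mul1r big_seq1; apply: (@le_trans _ _ (1 * \sum_(q <- index_iota k.+1 top.+1) (gap om q).+1%:R)).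
    by rewrite ler_wpM2r ?sumr_ge0 //; case: (0 < _)%N.
  rewrite mul1r -natr_sum ler_nat -(gap_total oS) split_level op.
  under eq_bigr do rewrite -addn1.
  rewrite big_split /= sum_nat_const_nat; lia.
move: le2; rewrite natrD; have : (m - phi - s)%:R <= (m - phi - j)%:R :> R by rewrite ler_nat.
set D := (m - phi - j)%:R; set D0 := (m - phi - s)%:R in d0 st *.
move: (#|U j|%:R) (#|U j.+1|%:R : R) (ler0n R #|U j|) (ler0n R #|U j.+1|) => X Y X0 Y0 DD le2.
have D1 : 0 < D by apply: lt_le_trans DD.
have mu1 : top%:R / D <= top%:R / D0 by rewrite ler_wpM2l // lef_pV2.
apply: (@le_trans _ _ ((1 - top%:R / D) * X)); first by rewrite ler_wpM2r // lerD2l lerN2.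
have [XY|XY] := leP X Y; first by rewrite (le_trans _ XY) // ler_piMl // gerBl divr_ge0 // ltW.
rewrite -(ler_pM2l D1) mulrA mulrBr mulr1 mulrCA divff ?gt_eqF // mulr1.
nra.
Qed.
End UpClosed.
End GapSystems.

(** * Positions with large probability are rare *)

Section Windows.
Variables (R : realFieldType) (Omega : finType) (gap : Omega -> nat -> nat).
Variables (S : {set Omega}) (top m : nat).
Hypothesis gap_total : forall om, om \in S -> level gap om top.+1 = m.
Hypothesis injS : gap_inj gap S.
Hypothesis transferS : forall om p q, om \in S -> (p < q <= top)%N ->
  (0 < gap om q)%N -> exists2 om', om' \in S & transfers gap p q om om'.

Lemma card_set_sum (P : pred Omega) :
  #|[set om in S | P om]|%:R = \sum_(om in S) (P om)%:R :> R.
Proof.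
rewrite -sum1_card natr_sum [RHS]big_mkcond [LHS]big_mkcond /=.
by apply: eq_bigr => om _; rewrite inE; case: (om \in S); case: (P om).
Qed.

(** States with the level [phi t] fall into three classes: those where the density does not drop by
    more than [x] and is at least [th] ([E]), those where it is below [th] ([L]), and those where it
    drops by more than [x]. A drop of the last kind pays for itself in the telescoping sum. *)
Lemma sum_level_le (kappa phi : nat -> nat) (T W s l C : nat) (th x a : R) :
  (0 < W)%N -> (0 < s)%N -> 0 < th -> 0 < x -> 0 < a <= 1 ->
  (forall t, (t <= T)%N -> (kappa t + W <= kappa t.+1)%N) ->
  (kappa T.+1 <= top.+1)%N ->
  (forall t, (4 * phi t <= 3 * m)%N) -> (m + top < C * m)%N ->
  x + 2 * s%:R / W%:R <= th / (2 * s%:R) -> 4 * l%:R <= a * W%:R ->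
  \sum_(0 <= t < T) #|[set om in S | level gap om (kappa t.+1) == phi t]|%:R
    <= (T%:R * (2 / s%:R + 4 * C%:R * (th + W%:R^-1))
        + (1 + T%:R * (a + (1 - a / 2) ^+ l)) / x) * #|S|%:R.
Proof.
move=> W0 s0 th0 x0 a01 kW kT phim mtop xs aW.
pose d t om := density R gap om (kappa t) (kappa t.+1).
pose V t om := level gap om (kappa t.+1) == phi t.
pose E t om := [&& V t om, th <= d t om & d t om - x <= d t.+1 om].
pose L t om := V t om && (d t om < th).
pose J t om := d t om + a <= d t.+1 om.
have ktop t : (t < T)%N -> (kappa t.+2 <= top.+1)%N.
  move=> tT; apply: leq_trans kT; elim: T {phim} kW tT => // T' IH kW.
  rewrite ltnS leq_eqVlt => /orP[/eqP->//|tT'].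
  apply: leq_trans (IH _ tT') _; first by move=> i iT; apply: kW; lia.
  by have := kW T'.+1 (leqnn _); lia.
(* The downward jumps of the density telescope up to its rare upward jumps.    *)
have pw t om : (V t om)%:R <= (E t om)%:R + (L t om)%:R
      + (d t om - d t.+1 om + a + (J t om)%:R) / x.
  have Jge : d t.+1 om - d t om <= a + (J t om)%:R.
    rewrite /J; case: (leP (d t om + a) (d t.+1 om)) => dJ /=.
      have := density_le1 R gap om (kappa t.+1) (kappa t.+2).
      by have := density_ge0 R gap om (kappa t) (kappa t.+1); rewrite -!/(d _ _); lra.
    lra.
  have q0 : 0 <= (d t om - d t.+1 om + a + (J t om)%:R) / x.
    by rewrite divr_ge0 ?(ltW x0) //; lra.
  rewrite /E /L; case: (V t om) => /=; last lra.
  case: (leP th (d t om)) => dth /=; last lra.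
  case: (leP (d t om - x)) => dx /=; first lra.
  have : 1 <= (d t om - d t.+1 om + a + (J t om)%:R) / x.
    have : 0 <= (J t om)%:R :> R by [].
    by rewrite ler_pdivlMr // mul1r; case/andP: a01; lra.
  lra.
have kk t : (t < T)%N -> [/\ (kappa t + W <= kappa t.+1)%N,
    (kappa t.+1 + W <= kappa t.+2)%N & (kappa t.+2 <= top.+1)%N].
  by move=> tT; split; rewrite ?kW ?ktop // ltnW.
have eE t : (t < T)%N -> \sum_(om in S) (E t om)%:R <= 2 / s%:R * #|S|%:R :> R.
  move=> tT; have [k1 k2 k3] := kk t tT; rewrite -card_set_sum.
  exact: level_small W0 k1 k2 k3 s0 th0 xs.
have eL t : (t < T)%N ->
    \sum_(om in S) (L t om)%:R <= 4 * C%:R * (th + W%:R^-1) * #|S|%:R :> R.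
  move=> tT; have [k1 k2 k3] := kk t tT; rewrite -card_set_sum.
  have k4 : (kappa t.+1 <= top)%N by rewrite -ltnS; apply: leq_trans k3; lia.
  exact: low_density_small W0 k1 k4 (ltW th0) (phim t) mtop.
have eJ t : (t < T)%N -> \sum_(om in S) (J t om)%:R <= (1 - a / 2) ^+ l * #|S|%:R :> R.
  move=> tT; have [k1 k2 k3] := kk t tT; rewrite -card_set_sum.
  exact: density_jump W0 k1 k2 k3 a01 aW.
apply: (@le_trans _ _ (\sum_(0 <= t < T) \sum_(om in S)
   ((E t om)%:R + (L t om)%:R + (d t om - d t.+1 om + a + (J t om)%:R) / x))).
  by apply: ler_sum => t _; rewrite card_set_sum; apply: ler_sum => om _; apply: pw.
have sumTS (r : R) : \sum_(0 <= t < T) (r * #|S|%:R) = T%:R * r * #|S|%:R.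
  by rewrite sumr_const_nat subn0 -mulrA mulr_natl.
rewrite (eq_bigr (fun t => (\sum_(om in S) (E t om)%:R + \sum_(om in S) (L t om)%:R)
   + (\sum_(om in S) (d t om - d t.+1 om) + a * #|S|%:R + \sum_(om in S) (J t om)%:R) / x));
  last first.
  move=> t _; rewrite !big_split /= -mulr_suml !big_split /= sumr_const mulr_natr.
  by [].
rewrite big_split /= -mulr_suml mulrDl; apply: lerD.
  rewrite mulrDr mulrDl -!sumTS -big_split /= !big_nat; apply: ler_sum => t /andP[_ tT].
  by apply: lerD; [apply: eE|apply: eL].
rewrite mulrAC ler_pM2r ?invr_gt0 // mulrDl mul1r !big_split /=.
rewrite -addrA; apply: lerD.
  rewrite exchange_big /= -sum1_card natr_sum; apply: ler_sum => om _.
  rewrite (eq_bigr (fun t => - (d t.+1 om - d t om))); last by move=> t _; rewrite opprB.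
  rewrite sumrN telescope_sumr // opprB.
  have := density_le1 R gap om (kappa 0%N) (kappa 1%N).
  by have := density_ge0 R gap om (kappa T) (kappa T.+1); rewrite -!/(d _ _); lra.
rewrite mulrDr mulrDl; apply: lerD; first by rewrite sumTS.
by rewrite -sumTS !big_nat; apply: ler_sum => t /andP[_ tT]; apply: eJ.
Qed.
End Windows.

(** * Choice of the constants *)

Lemma exists_natr_ge (R : realType) (x : R) : exists2 n : nat, (0 < n)%N & x <= n%:R.
Proof.
exists (Num.bound `|x|).+1 => //; apply: le_trans (ler_norm x) _.
by apply: ltW; apply: lt_trans (archi_boundP (normr_ge0 x)) _; rewrite ltr_nat.
Qed.

(** Relative to [T], the error terms of [sum_level_le] get [eps / 5] each. The choices are made in
    the order [s], [th], [x], [a], [l], [W]; then [T] absorbs the term [1 / x] left by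
    telescoping. *)
Lemma levels_rare (R : realType) (C : nat) (eps : R) : 0 < eps <= 1 ->
  exists T W : nat, [/\ (0 < T)%N, (0 < W)%N &
  forall (Omega : finType) (gap : Omega -> nat -> nat) (S : {set Omega}) (top m : nat)
    (kappa phi : nat -> nat),
  (forall om, om \in S -> level gap om top.+1 = m) ->
  gap_inj gap S ->
  (forall om p q, om \in S -> (p < q <= top)%N ->
    (0 < gap om q)%N -> exists2 om', om' \in S & transfers gap p q om om') ->
  (forall t, (t <= T)%N -> (kappa t + W <= kappa t.+1)%N) ->
  (kappa T.+1 <= top.+1)%N ->
  (forall t, (4 * phi t <= 3 * m)%N) -> (m + top < C * m)%N ->
  \sum_(0 <= t < T) #|[set om in S | level gap om (kappa t.+1) == phi t]|%:R
    <= eps * T%:R * #|S|%:R].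
Proof.
move=> /andP[e0 e1].
have [s s0 hs] := exists_natr_ge (10 / eps).
have hs0 : 0 < s%:R :> R by rewrite ltr0n.
have hC : 0 < C.+1%:R :> R by rewrite ltr0n.
have [th thE] : {th | th = eps / (40 * C.+1%:R)} by exists (eps / (40 * C.+1%:R)).
have th0 : 0 < th by rewrite thE divr_gt0 // mulr_gt0.
have hC1 : 1 <= C.+1%:R :> R by rewrite ler1n.
have hs1 : 1 <= s%:R :> R by rewrite ler1n.
have th1 : th <= 1 by rewrite thE ler_pdivrMr ?mulr_gt0 //; lra.
have [x xE] : {x | x = th / (4 * s%:R)} by exists (th / (4 * s%:R)).
have x0 : 0 < x by rewrite xE divr_gt0 // mulr_gt0.
have x1 : x <= 1 by rewrite xE ler_pdivrMr ?mulr_gt0 //; lra.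
have [a aE] : {a | a = x * eps / 5} by exists (x * eps / 5).
have a0 : 0 < a by rewrite aE divr_gt0 // mulr_gt0.
have a1 : a <= 1 by rewrite aE; nra.
have [l l0 hl] := exists_natr_ge (2 / (a * a)).
have [W1 W10 hW1] := exists_natr_ge (4 * l%:R / a).
have [W2 W20 hW2] := exists_natr_ge (40 * C%:R / eps).
have [W3 W30 hW3] := exists_natr_ge (8 * s%:R * s%:R / th).
have [T T0 hT] := exists_natr_ge (5 / (x * eps)).
pose W := (W1 + W2 + W3)%N.
have W0 : (0 < W)%N by rewrite /W !addn_gt0 W10.
exists T, W; split => // Omega gap S top m kappa phi tot inj tr kW kT phim mtop.
have hW0 : 0 < W%:R :> R by rewrite ltr0n.
have W1W : W1%:R <= W%:R :> R by rewrite ler_nat /W -addnA leq_addr.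
have W2W : W2%:R <= W%:R :> R by rewrite ler_nat /W addnAC leq_addl.
have W3W : W3%:R <= W%:R :> R by rewrite ler_nat /W leq_addl.
have aW : 4 * l%:R <= a * W%:R.
  by have := le_trans hW1 W1W; rewrite ler_pdivrMr //; lra.
have sW : 2 * s%:R / W%:R <= th / (4 * s%:R).
  rewrite ler_pdivrMr // mulrAC ler_pdivlMr ?mulr_gt0 //.
  have := le_trans hW3 W3W; rewrite ler_pdivrMr //; lra.
have xs : x + 2 * s%:R / W%:R <= th / (2 * s%:R).
  apply: le_trans (lerD (lexx _) sW) _; rewrite xE le_eqVlt; apply/orP; left; apply/eqP.
  by field; rewrite gt_eqF.
apply: le_trans (sum_level_le tot inj tr W0 s0 th0 x0 _ kW kT phim mtop xs aW) _.
  by rewrite a0.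
rewrite ler_wpM2r //.
have b1 : 2 / s%:R <= eps / 5.
  by move: hs; rewrite ler_pdivrMr // => hs; rewrite ler_pdivrMr //; lra.
have b2 : 4 * C%:R * th <= eps / 10.
  have ethC : th * (40 * C.+1%:R) = eps by rewrite thE divfK // gt_eqF ?mulr_gt0.
  have : C%:R * th <= C.+1%:R * th by rewrite ler_wpM2r ?(ltW th0) // ler_nat.
  lra.
have b3 : 4 * C%:R * W%:R^-1 <= eps / 10.
  by rewrite ler_pdivrMr //; move: (le_trans hW2 W2W); rewrite ler_pdivrMr //; lra.
have T0' : 0 < T%:R :> R by rewrite ltr0n.
have b4 : x^-1 <= T%:R * (eps / 5).
  move: hT; rewrite ler_pdivrMr ?mulr_gt0 // => hT.
  by rewrite -(ler_pM2r x0) mulVf ?gt_eqF //; lra.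
have b5 : a / x = eps / 5 by rewrite aE; field; rewrite gt_eqF.
(* The power is at most [1 / (1 + l * a / 2)] by induction, and [l] is at least [2 / (a * a)]. *)
have b6 : (1 - a / 2) ^+ l <= a.
  have bern j : (1 - a / 2) ^+ j * (1 + j%:R * (a / 2)) <= 1.
    elim: j => [|j IH]; first by rewrite mul0r addr0 mulr1.
    have p0 : 0 <= (1 - a / 2) ^+ j * (j%:R + 1) * (a / 2) ^+ 2.
      apply: mulr_ge0; last by rewrite exprn_ge0 // divr_ge0 // ltW.
      by apply: mulr_ge0; [apply: exprn_ge0; lra|rewrite addr_ge0].
    rewrite exprSr -[j.+1%:R]natr1; move: IH p0; set P := _ ^+ j; move: (j%:R : R) (a / 2) P => J b P IH p0.
    rewrite (_ : P * (1 - b) * (1 + (J + 1) * b)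
      = P * (1 + J * b) - P * (J + 1) * b ^+ 2); last by ring.
    by rewrite lerBlDr (le_trans IH) // lerDl.
  have := bern l; have : a^-1 <= l%:R * (a / 2).
    move: hl; rewrite ler_pdivrMr ?mulr_gt0 // => hl.
    by rewrite -(ler_pM2r a0) mulVf ?gt_eqF //; lra.
  have : 0 <= (1 - a / 2) ^+ l by apply: exprn_ge0; lra.
  move=> p0 la bl.
  have : (1 - a / 2) ^+ l * a^-1 <= 1 by nra.
  by rewrite ler_pdivrMr // mul1r.
have b7 : (1 - a / 2) ^+ l / x <= eps / 5 by rewrite -b5 ler_pM2r ?invr_gt0.
rewrite (_ : (1 + T%:R * (a + (1 - a / 2) ^+ l)) / x
   = x^-1 + T%:R * (a / x + (1 - a / 2) ^+ l / x)); last by field; rewrite gt_eqF.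
rewrite mulrDr.
have : T%:R * (2 / s%:R + (4 * C%:R * th + 4 * C%:R / W%:R)
   + (a / x + (1 - a / 2) ^+ l / x)) <= T%:R * (4 * eps / 5).
  by rewrite ler_pM2l //; lra.
lra.
Qed.

(** * Linear extensions as gap systems *)

Local Open Scope nat_scope.

Section LinearExtensions.
Variables (V : finType) (lt : rel V).

(** A copy of [linear_extension] for any finite type and relation; for the induced order the two are
    convertible, which [balance_gt] uses. *)
Definition linext (r : {ffun V * V -> bool}) : bool :=
  [&& [forall x, ~~ r (x, x)],
      [forall x, forall y, forall z, r (x, y) && r (y, z) ==> r (x, z)],
      [forall x, forall y, (x != y) ==> r (x, y) || r (y, x)]
    & [forall x, forall y, lt x y ==> r (x, y)]].

Definition linexts : {set {ffun V * V -> bool}} := [set r | linext r].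

Lemma linextP (r : {ffun V * V -> bool}) :
  reflect [/\ forall x, r (x, x) = false,
     forall x y z, r (x, y) -> r (y, z) -> r (x, z),
     forall x y, x != y -> r (x, y) || r (y, x)
   & forall x y, lt x y -> r (x, y)] (r \in linexts).
Proof.
rewrite inE; apply: (iffP and4P) => -[irr tr tot ext]; split.
- by move=> x; apply/negbTE/(forallP irr).
- move=> x y z xy yz; move/forallP/(_ x)/forallP/(_ y)/forallP/(_ z): tr.
  by rewrite xy yz.
- by move=> x y; apply/implyP; move/forallP/(_ x)/forallP: tot.
- by move=> x y; apply/implyP; move/forallP/(_ x)/forallP: ext.
- by apply/forallP => x; rewrite irr.
- apply/forallP => x; apply/forallP => y; apply/forallP => z.
  by apply/implyP => /andP[]; apply: tr.
- by apply/forallP => x; apply/forallP => y; apply/implyP/tot.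
- by apply/forallP => x; apply/forallP => y; apply/implyP/ext.
Qed.

Lemma linext_neg (r : {ffun V * V -> bool}) u v :
  r \in linexts -> u != v -> r (u, v) = ~~ r (v, u).
Proof.
move=> /linextP[irr tr tot _] uv; have := tot _ _ uv.
case: (boolP (r (u, v))) => ruv; case: (boolP (r (v, u))) => rvu //= _.
by have := tr _ _ _ ruv rvu; rewrite irr.
Qed.

End LinearExtensions.

Lemma card_ord_lt (n k : nat) : #|[set j : 'I_n | j < k]| = minn k n.
Proof.
rewrite -sum1_card big_mkcond.
rewrite (eq_bigr (fun j : 'I_n => (j < k) : nat)); last by move=> j _; rewrite inE; case: ifP.
rewrite -(big_mkord xpredT (fun j => (j < k) : nat)).
elim: n => [|n IH]; first by rewrite big_geq // minn0.
by rewrite big_nat_recr //= IH; lia.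
Qed.

Lemma mem_initial_segment (n : nat) (D : {set 'I_n}) (i : 'I_n) :
  (forall j k : 'I_n, j <= k -> k \in D -> j \in D) -> (i \in D) = (i < #|D|).
Proof.
move=> down; have [iD|niD] := boolP (i \in D).
  apply/esym; have := card_ord_lt n i.+1; rewrite (minn_idPl (ltn_ord i)) => <-.
  by apply: subset_leq_card; apply/subsetP => j; rewrite inE ltnS => ji; apply: down iD.
apply/esym/negbTE; rewrite -leqNgt; have := card_ord_lt n i.
rewrite (minn_idPl (ltnW (ltn_ord i))) => <-.
apply: subset_leq_card; apply/subsetP => j jD; rewrite inE ltnNge.
by apply: contra niD => ij; apply: down jD.
Qed.

Section Chain.
Variables (V : finType) (lt : rel V) (M : nat) (x : 'I_M -> V).
Hypothesis ltx : forall i j, lt (x i) (x j) = (i < j).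
Local Notation LE := (linexts lt).
Implicit Types (r : {ffun V * V -> bool}) (u v z : V).

Lemma chain_inj : injective x.
Proof.
move=> i j xij; have ij := ltx i j; have ji := ltx j i.
move: ij ji; rewrite xij ltx ltnn => ij ji; apply: val_inj => /=; lia.
Qed.

Definition others : {set V} := [set z | z \notin codom x].
Definition before r v : nat := #|[set i | r (x i, v)]|.
Definition rank r v : nat := #|[set z in others | r (z, v)]|.
Definition chain_gap r k : nat := #|[set i | rank r (x i) == k]|.
(** The restricted order keeps the type of [r], with [false] outside [others], so that its values
    index the fibers. *)
Definition restrict r : {ffun V * V -> bool} :=
  [ffun uv => [&& uv.1 \in others, uv.2 \in others & r uv]].
Definition fiber t : {set {ffun V * V -> bool}} := [set r in LE | restrict r == t].

Lemma others_codom u : (exists i, u = x i) \/ u \in others.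
Proof. by rewrite inE; have [/codomP[i ->]|] := boolP (u \in codom x); [left; exists i|right]. Qed.

Lemma others_neq z i : z \in others -> x i != z.
Proof. by rewrite inE; apply: contra => /eqP <-; apply: codom_f. Qed.

Lemma card_others : #|others| = #|V| - M.
Proof.
have -> : others = ~: [set u in codom x] by apply/setP => u; rewrite !inE.
by rewrite cardsCs setCK cardsE card_codom ?card_ord //; apply: chain_inj.
Qed.

Lemma chain_r r i j : r \in LE -> r (x i, x j) = (i < j).
Proof.
move=> rL; have [irr tr tot ext] := linextP _ _ rL.
have [ij|ji|/val_inj ->] := ltngtP i j; last by rewrite irr.
  by rewrite ext ?ltx.
by apply/negbTE; rewrite -(linext_neg rL) ?ext ?ltx // eq_sym; apply: contraTneq ji => /chain_inj ->; rewrite ltnn.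
Qed.

Lemma chain_before r i z : r \in LE -> z \in others -> r (x i, z) = (i < before r z).
Proof.
move=> rL zO; have [irr tr tot ext] := linextP _ _ rL.
rewrite -mem_initial_segment ?inE // => j k jk; rewrite !inE.
move: jk; rewrite leq_eqVlt => /orP[/eqP/val_inj -> //|jk]; apply: tr.
by rewrite chain_r.
Qed.

Lemma before_chain r i z : r \in LE -> z \in others -> r (z, x i) = (before r z <= i).
Proof.
by move=> rL zO; rewrite (linext_neg rL) ?chain_before -?leqNgt // eq_sym others_neq.
Qed.

Lemma rankE r z v : r \in LE -> z \in others -> r (z, v) = (rank r z < rank r v).
Proof.
move=> rL zO; have [irr tr tot ext] := linextP _ _ rL.
have [zv|nzv] := boolP (r (z, v)).
  apply/esym/proper_card/properP; split.
    by apply/subsetP => z'; rewrite !inE => /andP[-> /tr]; apply.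
  by exists z; rewrite inE ?irr ?andbF // zO.
apply/esym/negbTE; rewrite -leqNgt.
have [->//|zv] := eqVneq z v.
apply/subset_leq_card/subsetP => z'; rewrite !inE => /andP[-> /tr].
by apply; rewrite (linext_neg rL) // eq_sym.
Qed.

Lemma rank_lt r z : r \in LE -> z \in others -> rank r z < #|others|.
Proof.
move=> /linextP[irr _ _ _] zO; apply: proper_card; apply/properP; split.
  by apply/subsetP => z'; rewrite !inE => /andP[].
by exists z; rewrite // inE irr andbF.
Qed.

Lemma rank_le r v : rank r v <= #|others|.
Proof. by apply/subset_leq_card/subsetP => z'; rewrite !inE => /andP[]. Qed.

Lemma rank_inj r : r \in LE -> {in others &, injective (rank r)}.
Proof.
move=> rL z z' zO zO' e; apply/eqP/negP => /negP zz'.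
have [irr _ tot _] := linextP _ _ rL.
by have := tot _ _ zz'; rewrite !rankE // e ltnn.
Qed.

Lemma rank_surj r k : r \in LE -> k < #|others| -> exists2 z, z \in others & rank r z = k.
Proof.
move=> rL kO; pose f z : 'I_#|others|.+1 := inord (rank r z).
have fE z : f z = rank r z :> nat by rewrite /f inordK // ltnS rank_le.
pose D := [set j : 'I_#|others|.+1 | j < #|others|].
have sub : f @: others \subset D.
  by apply/subsetP => _ /imsetP[z zO ->]; rewrite inE fE rank_lt.
have : f @: others = D.
  apply/eqP; rewrite eqEcard sub card_ord_lt (minn_idPl (leqnSn _)) card_in_imset ?leqnn //.
  by move=> z z' zO zO' /(congr1 val); rewrite /= !fE; apply: rank_inj.
have kO' : k < #|others|.+1 by rewrite ltnS ltnW.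
move=> /setP/(_ (inord k)); rewrite [in RHS]inE inordK // kO.
by move=> /imsetP[z zO /(congr1 val)] /=; rewrite fE inordK // => ->; exists z.
Qed.

Lemma level_chain r k : level chain_gap r k = #|[set i | rank r (x i) < k]|.
Proof.
rewrite /level; elim: k => [|k IH].
  by rewrite big_geq //; apply/esym/eqP; rewrite cards_eq0; apply/eqP/setP => i; rewrite !inE.
rewrite big_nat_recr //= IH /chain_gap -cardsUI [X in _ + X](_ : _ = 0) ?addn0.
  by apply: eq_card => i; rewrite !inE ltnS orbC -leq_eqVlt.
by apply/eqP; rewrite cards_eq0; apply/eqP/setP => i; rewrite !inE; case: ltngtP.
Qed.

(** The outside element of rank [k] separates the gaps [0, ..., k] from the later ones. *)
Lemma level_rank r z : r \in LE -> z \in others -> level chain_gap r (rank r z).+1 = before r z.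
Proof.
move=> rL zO; rewrite level_chain /before; apply: eq_card => i; rewrite !inE ltnS.
by rewrite leqNgt -rankE // [RHS](linext_neg rL) // others_neq.
Qed.

Lemma level_total r : level chain_gap r #|others|.+1 = M.
Proof.
rewrite level_chain -[RHS]card_ord -cardsT; apply: eq_card => i.
by rewrite !inE ltnS rank_le.
Qed.

Lemma restrict_rank r r' z : restrict r = restrict r' -> z \in others -> rank r z = rank r' z.
Proof.
move=> /ffunP e zO; apply: eq_card => z'; rewrite ![in LHS]inE ![in RHS]inE.
case: (boolP (z' \in codom x)) => //= nz; have := e (z', z).
by rewrite !ffunE /= !inE nz; move: zO; rewrite inE => ->.
Qed.

Lemma fiberP t r : r \in fiber t -> r \in LE /\ restrict r = t.
Proof. by rewrite inE => /andP[? /eqP]. Qed.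

(** Partial sums of the gaps give [before] at every outside element, and with the order outside the
    chain this determines [r]. *)
Lemma fiber_gap_inj t : gap_inj chain_gap (fiber t).
Proof.
move=> r r' /fiberP[rL rt] /fiberP[rL' rt'] gg.
have lev k : level chain_gap r k = level chain_gap r' k by apply: eq_bigr.
have rr' : restrict r = restrict r' by rewrite rt.
have bb z : z \in others -> before r z = before r' z.
  by move=> zO; rewrite -!level_rank // (restrict_rank rr' zO).
apply/ffunP => -[u v].
have [[i ->]|uO] := others_codom u; have [[j ->]|vO] := others_codom v.
- by rewrite !chain_r.
- by rewrite !chain_before // bb.
- by rewrite !before_chain // bb.
- by have /ffunP/(_ (u, v)) := rr'; rewrite !ffunE /= uO vO.
Qed.

(** The move raises [before] by one at the outside elements with rank in [[p, q)] and keeps the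
    order within the chain and outside it. Only relations of the form [lt z (x i)] could break, and
    the last hypothesis prevents this. *)
Lemma chain_transfer r p q : r \in LE -> p < q <= #|others| -> 0 < chain_gap r q ->
  (forall z i, z \in others -> p <= rank r z < q -> lt z (x i) -> before r z < i) ->
  exists2 r', r' \in fiber (restrict r) & transfers chain_gap p q r r'.
Proof.
move=> rL /andP[pq qO] gq up; have [irr tr tot ext] := linextP _ _ rL.
have [iq iqP] : exists i, rank r (x i) = q.
  by move: gq; rewrite card_gt0 => /set0Pn[i]; rewrite inE => /eqP; exists i.
pose d z := before r z + (p <= rank r z < q).
pose idx u := [pick i | x i == u].
have idx_x i : idx (x i) = Some i.
  by rewrite /idx; case: pickP => [j /eqP/chain_inj->//|/(_ i)]; rewrite eqxx.
have idx_o z : z \in others -> idx z = None.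
  by move=> zO; rewrite /idx; case: pickP => // j; rewrite (negbTE (others_neq _ zO)).
pose r' : {ffun V * V -> bool} := [ffun uv =>
  match idx uv.1, idx uv.2 with
  | Some i, Some j => i < j
  | Some i, None => i < d uv.2
  | None, Some j => d uv.1 <= j
  | None, None => r uv
  end].
have rXX i j : r' (x i, x j) = (i < j) by rewrite ffunE /= !idx_x.
have rXO i z : z \in others -> r' (x i, z) = (i < d z) by move=> zO; rewrite ffunE /= idx_x idx_o.
have rOX i z : z \in others -> r' (z, x i) = (d z <= i) by move=> zO; rewrite ffunE /= idx_x idx_o.
have rOO z z' : z \in others -> z' \in others -> r' (z, z') = r (z, z').
  by move=> zO zO'; rewrite ffunE /= !idx_o.
have bmono z z' : z \in others -> z' \in others -> r (z, z') -> before r z <= before r z'.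
  move=> zO zO' zz'; apply/subset_leq_card/subsetP => i; rewrite !inE => /tr; exact.
(* The element [iq] of gap [q] comes after the outside elements of rank below [q] and before the
   rest. Hence [d] is still monotone and at most [M]. *)
have bq z : z \in others -> (before r z <= iq) = (rank r z < q).
  by move=> zO; rewrite -before_chain // rankE // iqP.
have dmono z z' : z \in others -> z' \in others -> r (z, z') -> d z <= d z'.
  move=> zO zO' zz'; have := bmono _ _ zO zO' zz'; have := zz'; rewrite rankE // /d.
  have := bq z zO; have := bq z' zO'; lia.
have dM z : z \in others -> d z <= M.
  move=> zO; rewrite /d; have := bq z zO; have := ltn_ord iq.
  have : before r z <= M by rewrite -[X in _ <= X]card_ord; apply: max_card.
  lia.
have rL' : r' \in LE.
  apply/linextP; split.
  - by move=> u; have [[i ->]|uO] := others_codom u; rewrite ?rXX ?ltnn ?rOO ?irr.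
  - move=> u v w; have [[i ->]|uO] := others_codom u; have [[j ->]|vO] := others_codom v;
      have [[k ->]|wO] := others_codom w; rewrite ?rXX ?rXO ?rOX ?rOO //.
    + exact: ltn_trans.
    + exact: ltn_trans.
    + exact: leq_trans.
    + by move=> iv /(dmono _ _ vO wO); apply: leq_trans iv.
    + by move=> uj /ltnW; apply: leq_trans uj.
    + move=> uj jw; rewrite rankE // ltnNge; apply/negP => wu.
      have : d w <= d u.
        move: wu; rewrite leq_eqVlt => /orP[/eqP/(rank_inj rL wO uO) ->//|].
        by rewrite -rankE // => /(dmono _ _ wO uO).
      by move=> /(leq_trans jw)/leq_trans/(_ uj); rewrite ltnn.
    + by move=> /(dmono _ _ uO vO); apply: leq_trans.
    + exact: tr.
  - move=> u v uv; have [[i ui]|uO] := others_codom u; have [[j vj]|vO] := others_codom v;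
      rewrite ?ui ?vj ?rXX ?rXO ?rOX ?rOO //; last exact: tot.
    + have : i != j by apply: contraNneq uv => ij; rewrite ui vj ij.
      by rewrite -(inj_eq val_inj) /=; lia.
    + by rewrite ltnNge orNb.
    + by rewrite ltnNge orbN.
  - move=> u v; have [[i ->]|uO] := others_codom u; have [[j ->]|vO] := others_codom v;
      rewrite ?rXX ?rXO ?rOX ?rOO ?ltx //.
    + by move=> /ext; rewrite chain_before // /d => h; rewrite ltn_addr.
    + move=> uj; have := ext _ _ uj; rewrite before_chain // /d.
      by case: (boolP (p <= rank r u < q)) => [/(up _ _ uO)/(_ uj)|]; lia.
    + exact: ext.
have rr' : restrict r' = restrict r.
  apply/ffunP => -[u v]; rewrite !ffunE /=.
  by case: (boolP (u \in others)) => //= uO; case: (boolP (v \in others)) => //= vO; rewrite !idx_o.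
exists r'; first by rewrite inE rL' rr' eqxx.
have bd z : z \in others -> before r' z = d z.
  move=> zO; rewrite /before; under eq_finset do rewrite rXO //.
  by rewrite card_ord_lt; apply/minn_idPl/dM.
(* A positive [k] is read off at the outside element of rank [k - 1]; beyond the last gap both
   levels are [M]. *)
have lev k : level chain_gap r' k = level chain_gap r k + (p < k <= q).
  have [kO|Ok] := leqP k #|others|; last first.
    rewrite !level_chain.
    have all s : #|[set i | rank s (x i) < k]| = M.
      rewrite -[RHS]card_ord -cardsT; apply: eq_card => i; rewrite !inE.
      exact: leq_ltn_trans (rank_le _ _) Ok.
    by rewrite !all; lia.
  case: k kO => [|k] kO; first by rewrite /level !big_geq.
  have [z zO zk] := rank_surj rL kO.
  rewrite -zk level_rank // -{1}(restrict_rank rr' zO) level_rank // bd // /d; lia.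
move=> k; have := lev k.+1; have := lev k; rewrite /level !big_nat_recr //= -!/(level _ _).
have : p < q by []; lia.
Qed.

End Chain.

Local Open Scope ring_scope.

Lemma sum_fibers_le (R : numDomainType) (V : finType) (lt : rel V) (M : nat) (x : 'I_M -> V)
    (f g : {ffun V * V -> bool} -> R) :
  (forall t, \sum_(r in fiber lt x t) f r <= \sum_(r in fiber lt x t) g r) ->
  \sum_(r in linexts lt) f r <= \sum_(r in linexts lt) g r.
Proof.
move=> fg; rewrite (partition_big (restrict x) predT) //= [leRHS](partition_big (restrict x) predT) //=.
have fibE F t : \sum_(r in linexts lt | restrict x r == t) F r = \sum_(r in fiber lt x t) F r :> R.
  by apply: eq_bigl => r; rewrite !inE.
by apply: ler_sum => t _; rewrite !fibE.
Qed.

(** * Down-closed chains, fiber by fiber *)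

Section DownClosedChain.
Variables (R : realType) (V : finType) (lt : rel V) (m : nat) (a : 'I_m -> V).
Hypothesis lta : forall i j, lt (a i) (a j) = (i < j)%N.
Hypothesis ideal_a : forall v i, lt v (a i) -> v \in codom a.
Local Notation LE := (linexts lt).

(** No outside element lies below an element of a down-closed chain, so every move to an earlier gap
    is legal. *)
Lemma ideal_transfer t (r : {ffun V * V -> bool}) p q : r \in fiber lt a t -> (p < q <= #|others a|)%N ->
  (0 < chain_gap a r q)%N -> exists2 r', r' \in fiber lt a t & transfers (chain_gap a) p q r r'.
Proof.
move=> /fiberP[rL <-] pq gq; apply: chain_transfer => // z i zO _ /ideal_a za.
by move: zO; rewrite inE za.
Qed.

Lemma card_fibers_le (c : R) (P : pred {ffun V * V -> bool}) :
  (forall t, fiber lt a t != set0 ->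
    #|[set r in fiber lt a t | P r]|%:R <= c * #|fiber lt a t|%:R) ->
  #|[set r in LE | P r]|%:R <= c * #|LE|%:R.
Proof.
move=> fc; rewrite card_set_sum mulr_natr -sumr_const; apply: (@sum_fibers_le _ _ _ _ a) => t.
rewrite sumr_const -[leRHS]mulr_natr -card_set_sum.
have [->|] := eqVneq (fiber lt a t) set0; last exact: fc.
rewrite cards0 mulr0 (_ : [set _ in _ | _] = set0) ?cards0 //.
by apply/setP => r; rewrite !inE.
Qed.

(** The rank of [y] is constant on a fiber, so its position is the level at one fixed index. *)
Lemma before_fiber t r0 r y : r0 \in fiber lt a t -> r \in fiber lt a t -> y \in others a ->
  before a r y = level (chain_gap a) r (rank a r0 y).+1.
Proof.
move=> /fiberP[_ rt0] /fiberP[rL rt] yO.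
by rewrite -(level_rank rL yO) (@restrict_rank _ _ _ r0 r) // rt0.
Qed.

Lemma before_small_few_others (y : V) (s phi : nat) :
  (0 < s)%N -> y \in others a -> (4 * phi <= 3 * m)%N ->
  (4 * s * (2 * #|others a| + 1) <= m)%N ->
  #|[set r in LE | before a r y == phi]|%:R <= 2 / s%:R * #|LE|%:R :> R.
Proof.
move=> s0 yO phim sm; apply: card_fibers_le => t /set0Pn[r0 r0t].
have [rL0 _] := fiberP r0t.
have -> : [set r in fiber lt a t | before a r y == phi]
    = [set r in fiber lt a t | level (chain_gap a) r (rank a r0 y).+1 == phi].
  apply/setP => r; rewrite [LHS]inE [RHS]inE.
  by case: (boolP (r \in fiber lt a t)) => rt //=; rewrite (before_fiber r0t rt yO).
have kt : (rank a r0 y < #|others a|)%N by apply: (rank_lt rL0 yO).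
apply: (level_small_few_gaps _ _ _ _ s0 kt phim sm).
- by move=> r _; apply: level_total.
- exact: fiber_gap_inj.
- by move=> r p q; apply: ideal_transfer.
Qed.

End DownClosedChain.

(** On each fiber the ranks of the [y t] are fixed and cut the gaps into windows of length at least
    [W], as [levels_rare] requires. *)
Lemma before_rare (R : realType) (C : nat) (eps : R) : 0 < eps <= 1 ->
  exists T W : nat, [/\ (0 < T)%N, (0 < W)%N &
  forall (V : finType) (lt : rel V) (m : nat) (a : 'I_m -> V) (y : nat -> V) (phi : nat -> nat),
  (forall i j, lt (a i) (a j) = (i < j)%N) ->
  (forall v i, lt v (a i) -> v \in codom a) ->
  (forall t, (t <= T.+1)%N -> y t \in others a) ->
  (forall r t, r \in linexts lt -> (t <= T)%N -> (rank a r (y t) + W <= rank a r (y t.+1))%N) ->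
  (forall t, (4 * phi t <= 3 * m)%N) -> (m + #|others a| < C * m)%N ->
  \sum_(0 <= t < T) #|[set r in linexts lt | before a r (y t.+1) == phi t]|%:R
    <= eps * T%:R * #|linexts lt|%:R].
Proof.
move=> e01; have [T [W [T0 W0 TW]]] := levels_rare C e01.
exists T, W; split => // V lt m a y phi lta ida yO rk phim mC.
under eq_bigr do rewrite card_set_sum.
rewrite exchange_big mulr_natr -sumr_const; apply: (@sum_fibers_le _ _ _ _ a) => t.
rewrite exchange_big sumr_const -[leRHS]mulr_natr /=.
have [->|/set0Pn[r0 r0t]] := eqVneq (fiber lt a t) set0.
  by rewrite cards0 mulr0 exchange_big big_set0.
have [rL0 _] := fiberP r0t.
pose kappa i := (rank a r0 (y i)).+1.
apply: le_trans (TW _ (chain_gap a) (fiber lt a t) #|others a| m kappa phi _ _ _ _ _ phim mC).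
- rewrite !big_nat; apply: ler_sum => i /andP[_ iT]; rewrite card_set_sum le_eqVlt; apply/orP; left.
  apply/eqP; apply: eq_bigr => r rt; rewrite (before_fiber r0t rt) //.
  by apply: yO; rewrite ltnS ltnW.
- by move=> r _; apply: level_total.
- exact: fiber_gap_inj.
- by move=> r p q; apply: ideal_transfer.
- by move=> i iT; rewrite /kappa addSn ltnS; apply: rk.
- by rewrite /kappa ltnS rank_le.
Qed.

(* Elements of [b] are moved before elements of [a]; the hypothesis that        *)
(* [lt (a i) (b j)] implies [i <= j] keeps the result a linear extension.       *)
Lemma late_chain_rare (R : realType) (V : finType) (lt : rel V) (m M : nat)
    (a : 'I_m -> V) (b : 'I_M -> V) (h : 'I_m) (K : nat) :
  (forall i j, lt (a i) (a j) = (i < j)%N) ->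
  (forall i j, lt (b i) (b j) = (i < j)%N) ->
  (forall j, b j \notin codom a) ->
  (forall v j, v \notin codom a -> lt v (b j) -> v \in codom b) ->
  (forall i j, lt (a i) (b j) -> (i <= j)%N) ->
  (0 < K <= M)%N -> (M <= h)%N ->
  ((h - K).+1 * (M - K).+1)%:R * #|[set r in linexts lt | (before b r (a h) < K)%N]|%:R
    <= (K * (#|V| - h))%:R * #|linexts lt|%:R :> R.
Proof.
move=> lta ltb ba idb ab /andP[K0 KM] Mh.
have Kh : (K <= h)%N := leq_trans KM Mh.
have aO i : a i \in others b.
  by rewrite inE; apply/codomP => -[j aj]; have := ba j; rewrite -aj codom_f.
pose N : R := (K * (#|V| - h))%:R; pose D : R := ((h - K).+1 * (M - K).+1)%:R.
have D0 : 0 < D by rewrite ltr0n muln_gt0.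
rewrite mulrC -ler_pdivlMr // mulrAC.
apply: (@card_fibers_le R V lt M b) => t /set0Pn[r0 r0t].
have [rL0 rt0] := fiberP r0t.
rewrite mulrAC ler_pdivlMr //.
have rk r i : r \in fiber lt b t -> rank b r (a i) = rank b r0 (a i).
  by move=> /fiberP[_ rt]; apply: restrict_rank; rewrite // rt0.
pose k i := rank b r0 (a i).
have kk i j : (k i < k j)%N = (i < j)%N by rewrite /k -(rankE _ rL0 (aO i)) (chain_r lta).
pose E := [set r in fiber lt b t | (before b r (a h) < K)%N].
pose E' := [set r in fiber lt b t | (before b r (a h) <= K)%N].
have EF : E \subset fiber lt b t by apply/subsetP => r; rewrite inE => /andP[].
(* Gap [k i] is the one that ends at [a i]; it receives elements of [b] from behind [a h]. *)
pose Ps := [seq k i | i <- enum [pred i : 'I_m | (K <= i <= h)%N]].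
have kh : (h <= k h)%N.
  rewrite /k /rank -[X in (X <= _)%N](minn_idPl (ltnW (ltn_ord h))) -card_ord_lt.
  rewrite -(card_imset _ (chain_inj lta)); apply/subset_leq_card/subsetP => _ /imsetP[i + ->].
  by rewrite inE => ih; rewrite inE aO (chain_r lta).
have ltkO : (k h < #|others b|)%N by apply: (rank_lt rL0 (aO h)).
have PsP p : p \in Ps -> exists2 i : 'I_m, (K <= i <= h)%N & p = k i.
  by move=> /mapP[i]; rewrite mem_enum inE => ih ->; exists i.
have Ps_uniq : uniq Ps.
  rewrite map_inj_uniq ?enum_uniq // => i j kij; apply/val_inj => /=.
  have := kk i j; have := kk j i; rewrite kij ltnn; lia.
have Ps_size : size Ps = (h - K).+1.
  rewrite size_map -cardE.
  have : (#|[set i : 'I_m | i < h.+1]| = #|[set i : 'I_m | i < K]|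
      + #|[pred i : 'I_m | K <= i <= h]|)%N.
    rewrite -(cardsID [set i : 'I_m | i < K]%N); congr addn; apply: eq_card => i;
      rewrite !inE; lia.
  rewrite !card_ord_lt (minn_idPl (ltn_ord h)) (minn_idPl _); last first.
    by rewrite ltnW // (leq_ltn_trans _ (ltn_ord h)) // (leq_trans KM).
  by move=> e; rewrite -subSn // e addKn.
have bL r i : r \in fiber lt b t -> before b r (a i) = level (chain_gap b) r (k i).+1.
  by move=> rt; apply: before_fiber r0t rt (aO i).
unshelve epose proof (@transfer_double_count R _ (chain_gap b) E E' Ps
  (index_iota (k h).+1 #|others b|.+1) (fun=> 1) (fun=> 1) (fun n => n%:R)
  (gap_injS EF (@fiber_gap_inj _ _ _ _ ltb t)) _ _ _ _ _ _) as le1 => //.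
- move=> p q /PsP[i /andP[_ ih] ->]; rewrite mem_index_iota => /andP[hq _].
  by apply/eqP; have := kk h i; lia.
- move=> r p q; rewrite inE => /andP[rt rE] /PsP[i /andP[Ki ih] ->] qI gq.
  have kih : (k i <= k h)%N by rewrite leqNgt kk -leqNgt.
  have kiq : (k i <= k i < (k h).+1)%N by rewrite leqnn.
  have qI' : ((k h).+1 <= q < #|others b|.+1)%N by move: qI; rewrite mem_index_iota.
  have [rL rtt] := fiberP rt.
  have [|z j zO zI zb|r' r't tr] := @chain_transfer _ _ _ _ ltb r (k i) q rL _ gq.
  + lia.
  (* Only an element [a i'] can be crossed and lie below [b j]. For [i' <= h], fewer than
     [K <= i' <= j] elements of [b] precede it; for [i' > h], at most [M <= h < j] do. *)
  + have /codomP[i' zi'] : z \in codom a.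
      by apply: contraTT zO => za; rewrite inE negbK; apply: idb za zb.
    move: zI zb; rewrite zi' rk // -/(k i') => zI /ab i'j.
    have ii' : (i <= i')%N by rewrite leqNgt -kk -leqNgt; case/andP: zI.
    have [i'h|hi'] := leqP i' h.
      apply: (@leq_trans K); last by rewrite (leq_trans Ki) // (leq_trans ii').
      apply: leq_ltn_trans rE; rewrite !bL // !level_chain.
      apply: subset_leq_card; apply/subsetP => l; rewrite !inE => /leq_trans; apply.
      by rewrite ltnS leqNgt kk -leqNgt.
    have : (before b r (a i') <= M)%N by rewrite -[X in (_ <= X)%N]card_ord; apply: max_card.
    by move=> /leq_ltn_trans; apply; rewrite (leq_ltn_trans Mh) // (leq_trans hi').
  rewrite rtt in r't; exists r' => //; rewrite inE r't /= bL //.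
  by rewrite (transfers_level kiq qI' tr) -bL.
have split_level r : (level (chain_gap b) r #|others b|.+1 = level (chain_gap b) r (k h).+1
    + \sum_((k h).+1 <= q < #|others b|.+1) chain_gap b r q)%N.
  by rewrite /level (@big_cat_nat _ _ _ (k h).+1) //= ltnS ltnW.
have cV : (M + #|others b| = #|V|)%N.
  rewrite (card_others ltb) subnKC // -[X in (X <= _)%N]card_ord.
  by rewrite -(card_codom (chain_inj ltb)) max_card.
(* [D] bounds the moves out of a state from below. [N] bounds those into a state from above: at most
   [K] elements of [b] precede [a h], so at most [K] target gaps are nonempty. *)
have le2 : \sum_(r in E) D <= \sum_(r in E') N.
  apply: le_trans (le_trans le1 _).
    apply: ler_sum => r; rewrite inE => /andP[rt rE]; rewrite mul1r Ps_size /D natrM ler_pM2l //.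
    rewrite -natr_sum ler_nat; have := split_level r; rewrite level_total -bL //; lia.
  apply: ler_sum => r; rewrite inE => /andP[rt rE]; rewrite mul1r /N natrM.
  apply: ler_pM => //; first by rewrite sumr_ge0.
    rewrite ler_nat; apply: leq_trans rE; rewrite bL // /level.
    apply: (@leq_trans (\sum_(0 <= i < (k h).+1) (0 < chain_gap b r i)))%N; last first.
      by apply: leq_sum => i _; case: (chain_gap b r i).
    apply: (@uniq_sub_le_big nat addn leq leqnn (fun i j => leq_addr j i) 0%N _ Ps
      (index_iota 0 (k h).+1) xpredT (fun p => (0 < chain_gap b r p)%N : nat) Ps_uniq (iota_uniq _ _)).
    by move=> p /PsP[i /andP[_ ih] ->]; rewrite mem_index_iota /= ltnS leqNgt kk -leqNgt.
  rewrite -natr_sum ler_nat; under eq_bigr do rewrite -addn1.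
  rewrite big_split /= sum_nat_const_nat.
  apply: (@leq_trans (M + (#|others b|.+1 - (k h).+1) * 1)); last by rewrite -cV; lia.
  by rewrite leq_add2r -[X in (_ <= X)%N](level_total b r) split_level leq_addl.
move: le2; rewrite !sumr_const -[leLHS]mulr_natr -[leRHS]mulr_natr mulrC => /le_trans; apply.
rewrite ler_wpM2l // ler_nat; apply: subset_leq_card.
by apply/subsetP => r; rewrite inE => /andP[].
Qed.

(** * Balanced pairs from two chains *)

Definition prob_lt (R : realType) (V : finType) (lt : rel V) (u v : V) : R :=
  #|[set r in linexts lt | r (u, v)]|%:R / #|linexts lt|%:R.

Definition balanced_pair (R : realType) (V : finType) (lt : rel V) (eps : R) (u v : V) : Prop :=
  [/\ u != v, 1 / 2 - eps < prob_lt R lt u v & 1 / 2 - eps < prob_lt R lt v u].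

Lemma prob_lt_swap (R : realType) (V : finType) (lt : rel V) (u v : V) :
  linexts lt != set0 -> u != v -> prob_lt R lt u v = 1 - prob_lt R lt v u.
Proof.
move=> LE0 uv; have L0 : #|linexts lt|%:R != 0 :> R by rewrite pnatr_eq0 cards_eq0.
apply/eqP; rewrite eq_sym subr_eq eq_sym /prob_lt -mulrDl -natrD; apply/eqP.
rewrite -[RHS](divff L0); congr (_%:R / _).
rewrite -(cardsID [set r : {ffun V * V -> bool} | r (u, v)] (linexts lt)); congr addn.
  by apply: eq_card => r; rewrite !inE.
apply: eq_card => r; rewrite [LHS]inE [RHS]in_setD [X in ~~ X]inE andbC.
case: (boolP (r \in linexts lt)) => rL /=; last by rewrite ?andbF.
by rewrite ?andbT (linext_neg rL uv) negbK.
Qed.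

(** Let [phi] be the least index whose element precedes [y] with probability at most 1/2. Without
    balanced pairs this probability is at most [1/2 - eps], and it is at least [1/2 + eps] one index
    earlier (for [phi = 0] the total mass is used). The difference is the probability that [before]
    equals [phi]. *)
Lemma median_level (R : realType) (V : finType) (lt : rel V) (m : nat) (a : 'I_m -> V)
    (h : 'I_m) (y : V) (eps : R) :
  (forall i j, lt (a i) (a j) = (i < j)%N) -> linexts lt != set0 -> y \in others a ->
  0 < eps <= 1 / 2 -> prob_lt R lt (a h) y <= 1 / 2 ->
  (forall i, ~ balanced_pair lt eps (a i) y) ->
  exists2 phi : nat, (phi <= h)%N &
    2 * eps * #|linexts lt|%:R <= #|[set r in linexts lt | before a r y == phi]|%:R.
Proof.
move=> lta LE0 yO /andP[eps0 eps2] ph nbal.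
have L0 : 0 < #|linexts lt|%:R :> R by rewrite ltr0n card_gt0.
pose N j := #|[set r in linexts lt | (j <= before a r y)%N]|.
have NS (i : 'I_m) : (N i.+1)%:R = prob_lt R lt (a i) y * #|linexts lt|%:R.
  rewrite /prob_lt divfK ?gt_eqF //; congr _%:R; apply: eq_card => r; rewrite [LHS]inE [RHS]inE.
  by case: (boolP (r \in linexts lt)) => //= rL; rewrite (chain_before lta i rL yO).
have ex : exists j, (2 * N j.+1 <= #|linexts lt|)%N.
  by exists h; rewrite -(ler_nat R) natrM NS; nra.
have hex : (2 * N h.+1 <= #|linexts lt|)%N by rewrite -(ler_nat R) natrM NS; nra.
pose phi := ex_minn ex; have [Nphi phimin] : (2 * N phi.+1 <= #|linexts lt|)%N /\
    forall j, (2 * N j.+1 <= #|linexts lt|)%N -> (phi <= j)%N.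
  by rewrite /phi; case: ex_minnP.
have ih := phimin _ hex; exists phi => //.
have NE : (N phi)%:R = #|[set r in linexts lt | before a r y == phi]|%:R + (N phi.+1)%:R :> R.
  rewrite -natrD; congr _%:R.
  rewrite /N -(cardsID [set r : {ffun V * V -> bool} | before a r y == phi]); congr addn.
    by apply: eq_card => r; rewrite !inE; case: eqP => [->|]; rewrite ?leqnn ?andbT ?andbF.
  apply: eq_card => r; rewrite !inE ltn_neqAle [phi == _]eq_sym.
  by case: (_ == phi); rewrite ?andbF ?andbT.
have neq i : a i != y by apply: others_neq.
have phim : (phi < m)%N := leq_ltn_trans ih (ltn_ord h).
have up : (N phi.+1)%:R <= (1 / 2 - eps) * #|linexts lt|%:R.
  have := NS (Ordinal phim); rewrite /= => NSp.
  rewrite NSp ler_pM2r // leNgt; apply/negP => gt; apply: (nbal (Ordinal phim)); split => //.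
  rewrite (prob_lt_swap _ LE0) 1?eq_sym //.
  have : prob_lt R lt (a (Ordinal phim)) y <= 1 / 2; last lra.
  by rewrite -(ler_pM2r L0); move: Nphi; rewrite -(ler_nat R) natrM NSp; lra.
have lo : (1 / 2 + eps) * #|linexts lt|%:R <= (N phi)%:R.
  case E : phi => [|j].
    have -> : N 0%N = #|linexts lt| by apply: eq_card => r; rewrite !inE andbT.
    by apply: ler_piMl; [exact: ltW|lra].
  have jm : (j < m)%N by lia.
  have NSp := NS (Ordinal jm); rewrite /= in NSp; rewrite NSp ler_pM2r //.
  have : (#|linexts lt| < 2 * N j.+1)%N by rewrite ltnNge; apply/negP => /phimin; rewrite E ltnn.
  rewrite -(ltr_nat R) natrM NSp => gt.
  rewrite leNgt; apply/negP => lt'; apply: (nbal (Ordinal jm)); split => //.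
    by rewrite (lt_trans _ (_ : 1 / 2 < _)) //; [lra | rewrite -(ltr_pM2r L0); lra].
  by rewrite (prob_lt_swap _ LE0) 1?eq_sym //; lra.
lra.
Qed.

Lemma prob_lt_mono (R : realType) (V : finType) (lt : rel V) (u v w : V) :
  (v = w \/ lt v w) -> prob_lt R lt u v <= prob_lt R lt u w.
Proof.
move=> vw; rewrite ler_wpM2r ?invr_ge0 // ler_nat; apply/subset_leq_card/subsetP => r.
rewrite inE => /andP[rL uv]; rewrite inE rL /=; case: vw => [<-//|vw].
by have [_ tr _ ext] := linextP _ _ rL; apply: tr uv (ext _ _ vw).
Qed.

(** That [a h] precedes [b K] means that at most [K] elements of [b] precede [a h], the event of
    [late_chain_rare]. *)
Lemma prob_late (R : realType) (V : finType) (lt : rel V) (m M : nat)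
    (a : 'I_m -> V) (b : 'I_M -> V) (h : 'I_m) (K : 'I_M) :
  (forall i j, lt (a i) (a j) = (i < j)%N) ->
  (forall i j, lt (b i) (b j) = (i < j)%N) ->
  (forall j, b j \notin codom a) ->
  (forall v j, v \notin codom a -> lt v (b j) -> v \in codom b) ->
  (forall i j, lt (a i) (b j) -> (i <= j)%N) -> (M <= h)%N ->
  linexts lt != set0 ->
  (2 * (K.+1 * (#|V| - h)) <= (h - K.+1).+1 * (M - K.+1).+1)%N ->
  prob_lt R lt (a h) (b K) <= 1 / 2.
Proof.
move=> lta ltb ba idb ab Mh LE0 KK.
have L0 : 0 < #|linexts lt|%:R :> R by rewrite ltr0n card_gt0.
have K1 : (0 < K.+1 <= M)%N by rewrite /= ltn_ord.
have := late_chain_rare R lta ltb ba idb ab K1 Mh.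
have ahO : a h \in others b.
  by rewrite inE; apply/codomP => -[j aj]; have := ba j; rewrite -aj codom_f.
have -> : [set r in linexts lt | (before b r (a h) < K.+1)%N] = [set r in linexts lt | r (a h, b K)].
  apply/setP => r; rewrite [LHS]inE [RHS]inE; case: (boolP (r \in linexts lt)) => //= rL.
  by rewrite (before_chain ltb K rL ahO).
rewrite /prob_lt ler_pdivrMr //; set c := #|_|%:R => bound.
have D0 : 0 < ((h - K.+1).+1 * (M - K.+1).+1)%:R :> R by rewrite ltr0n.
move: KK; rewrite -(ler_nat R) natrM => KK; rewrite -(ler_pM2l D0).
apply: le_trans bound _; rewrite mulrA ler_wpM2r //; lra.
Qed.

(** Without balanced pairs each [b (t * W)] with [1 <= t <= T] has a position of probability at
    least [2 * eps], while [before_rare] bounds the average by [eps]. *)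
Lemma balanced_of_long_chain (R : realType) (C : nat) (eps : R) : 0 < eps <= 1 / 2 ->
  exists M0 N : nat,
  forall (V : finType) (lt : rel V) (m M : nat) (a : 'I_m -> V) (b : 'I_M -> V),
  (forall i j, lt (a i) (a j) = (i < j)%N) ->
  (forall i j, lt (b i) (b j) = (i < j)%N) ->
  (forall v i, lt v (a i) -> v \in codom a) ->
  (forall j, b j \notin codom a) ->
  (forall v j, v \notin codom a -> lt v (b j) -> v \in codom b) ->
  (forall i j, lt (a i) (b j) -> (i <= j)%N) ->
  linexts lt != set0 ->
  (N <= m)%N -> (#|V| <= C * m)%N -> (M0 <= M <= 3 * m %/ 4)%N ->
  exists u v, balanced_pair lt eps u v.
Proof.
move=> /andP[e0 e2]; have e01 : 0 < eps <= 1 by rewrite e0 /=; lra.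
have [T [W [T0 W0 rare]]] := before_rare C.+1 e01.
pose K := (T.+1 * W)%N.
(* The part [8 * C * K.+1] of the length of [b] outweighs [#|V| <= C * m] in [prob_late]. *)
exists (K.+1 + 8 * C * K.+1)%N, (8 * K.+1 + 8)%N => V lt m M a b lta ltb ida ba idb ab LE0 Nm Vm.
move=> /andP[M0M Mh].
have hm : (3 * m %/ 4 < m)%N by lia.
pose h := Ordinal hm.
have KM : (K < M)%N by lia.
apply: contrapT => nbal.
have L0 : 0 < #|linexts lt|%:R :> R by rewrite ltr0n card_gt0.
(* The default [b K] is never reached, as only indices up to [K] occur. *)
pose bn j := b (insubd (Ordinal KM) j).
have bnE j (jM : (j < M)%N) : bn j = b (Ordinal jM).
  by rewrite /bn; congr b; apply/val_inj; rewrite /= val_insubd jM.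
have bO j : bn j \in others a by rewrite inE ba.
have rank_b r i n : r \in linexts lt -> (i + n < M)%N -> (rank a r (bn i) + n <= rank a r (bn (i + n)))%N.
  move=> rL; elim: n => [|n IH] inM; first by rewrite !addn0.
  have k1 : ((i + n).+1 < M)%N by rewrite -addnS.
  have k0 : (i + n < M)%N := ltnW k1.
  rewrite !addnS; apply: leq_ltn_trans (IH k0) _.
  by rewrite -(rankE _ rL (bO _)) (bnE _ k0) (bnE _ k1) (chain_r ltb) /=.
have late : prob_lt R lt (a h) (b (Ordinal KM)) <= 1 / 2.
  apply: (@prob_late R V lt m M a b h (Ordinal KM) lta ltb ba idb ab Mh LE0) => /=.
  have h1 : (m <= 4 * (3 * m %/ 4 - K.+1).+1)%N by lia.
  have h2 : (8 * C * K.+1 <= (M - K.+1).+1)%N by lia.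
  apply: (@leq_trans (2 * (K.+1 * (C * m)))).
    by rewrite leq_pmul2l // leq_pmul2l // (leq_trans (leq_subr _ _)).
  apply: (@leq_trans ((3 * m %/ 4 - K.+1).+1 * (8 * C * K.+1))); last by rewrite leq_mul2l h2 orbT.
  have := leq_mul (leqnn (2 * (C * K.+1))) h1; lia.
pose y t := bn (t * W)%N.
have tK t : (t <= T.+1)%N -> (t * W <= K)%N by move=> tT; rewrite leq_mul2r tT orbT.
have /choice[phi phiP] t : exists phi, (phi <= h)%N /\ ((t < T)%N ->
    2 * eps * #|linexts lt|%:R <= #|[set r in linexts lt | before a r (y t.+1) == phi]|%:R).
  have [tT|] := leqP T t; first by exists 0%N.
  move=> tT; have e02 : 0 < eps <= 1 / 2 by rewrite e0.
  have [|i|phi ph hphi] := @median_level R V lt m a h (y t.+1) eps lta LE0 (bO _) e02.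
  - apply: le_trans late; apply: prob_lt_mono; rewrite /y.
    have tK' := tK t.+1 (leqW tT); have tM : (t.+1 * W < M)%N := leq_ltn_trans tK' KM.
    rewrite (bnE _ tM); case: (ltngtP (t.+1 * W)%N K) tK' => // [ltK _|eK _].
      by right; rewrite ltb.
    by left; congr b; apply: val_inj.
  - by move=> bal; apply: nbal; exists (a i), (y t.+1).
  by exists phi.
have phim t : (4 * phi t <= 3 * m)%N.
  have [ph _] := phiP t; rewrite /= in ph; lia.
have others_m : (m + #|others a| < C.+1 * m)%N.
  have mV : (m <= #|V|)%N.
    by rewrite -[X in (X <= _)%N]card_ord -(card_codom (chain_inj lta)) max_card.
  rewrite (card_others lta) subnKC // mulSn; lia.
have rk r t : r \in linexts lt -> (t <= T)%N -> (rank a r (y t) + W <= rank a r (y t.+1))%N.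
  move=> rL tT; rewrite /y mulSn [(W + _)%N]addnC; apply: rank_b => //.
  by apply: leq_ltn_trans (KM); rewrite addnC -mulSn; apply: tK.
have le := rare V lt m a y phi lta ida (fun t _ => bO _) rk phim others_m.
have : \sum_(0 <= t < T) 2 * eps * #|linexts lt|%:R <= eps * T%:R * #|linexts lt|%:R.
  by apply: le_trans le; rewrite !big_nat; apply: ler_sum => t /andP[_ tT]; have [_] := phiP t; apply.
rewrite sumr_const_nat subn0 -mulr_natr.
have : 0 < eps * T%:R * #|linexts lt|%:R by rewrite !mulr_gt0 // ltr0n.
lra.
Qed.

(** One minimal element [y] outside [a] suffices: it serves as a chain of length one in [prob_late],
    and [before_small_few_others] makes each of its relevant positions improbable. *)
Lemma balanced_of_few_others (R : realType) (R0 : nat) (eps : R) : 0 < eps <= 1 / 2 ->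
  exists N : nat,
  forall (V : finType) (lt : rel V) (m : nat) (a : 'I_m -> V) (y : V),
  (forall i j, lt (a i) (a j) = (i < j)%N) -> ~~ lt y y ->
  (forall v i, lt v (a i) -> v \in codom a) ->
  y \notin codom a ->
  (forall v, v \notin codom a -> ~~ lt v y) ->
  (forall i : 'I_m, lt (a i) y -> (i <= 0)%N) ->
  linexts lt != set0 ->
  (N <= m)%N -> (#|others a| <= R0)%N ->
  exists u v, balanced_pair lt eps u v.
Proof.
move=> e02; have /andP[e0 e2] := e02.
have [s s0 hs] := exists_natr_ge (2 / eps).
exists (4 * s * (2 * R0 + 1) + 8 * R0 + 12)%N => V lt m a y lta yy ida ya my ay LE0 Nm om.
have mR : (8 * R0 + 12 <= m)%N by apply: leq_trans Nm; rewrite -addnA leq_addl.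
have hm : (3 * m %/ 4 < m)%N by lia.
pose h := Ordinal hm.
apply: contrapT => nbal.
have L0 : 0 < #|linexts lt|%:R :> R by rewrite ltr0n card_gt0.
have yO : y \in others a by rewrite inE.
have mV : (m <= #|V|)%N.
  by rewrite -[X in (X <= _)%N]card_ord -(card_codom (chain_inj lta)) max_card.
have late : prob_lt R lt (a h) y <= 1 / 2.
  apply: (@prob_late R V lt m 1 a (fun=> y) h ord0 lta) => //.
  - by move=> i j; rewrite !ord1 ltnn; apply: negbTE.
  - by move=> v j /my /negbTE ->.
  - by move=> i j /ay; rewrite ord1.
  - rewrite /=; lia.
  - have om2 : (#|V| - m <= R0)%N by rewrite -(card_others lta).
    change (2 * (1 * (#|V| - 3 * m %/ 4)) <= (3 * m %/ 4 - 1).+1 * 1)%N; lia.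
have [|phi ph hphi] := @median_level R V lt m a h y eps lta LE0 yO e02 late.
  by move=> i bal; apply: nbal; exists (a i), y.
have phim : (4 * phi <= 3 * m)%N by rewrite mulnC -leq_divRL.
have sm : (4 * s * (2 * #|others a| + 1) <= m)%N.
  apply: leq_trans Nm; rewrite -addnA; apply: (@leq_trans (4 * s * (2 * R0 + 1))); last exact: leq_addr.
  by rewrite leq_mul2l leq_add2r leq_mul2l om !orbT.
have := le_trans hphi (before_small_few_others R lta ida s0 yO phim sm).
rewrite ler_pM2r // => le; have : 2 / s%:R <= eps.
  move: hs; rewrite ler_pdivrMr // => hs; rewrite ler_pdivrMr ?ltr0n //; lra.
lra.
Qed.

(** Cutting [b] to length at most [3 * m / 4] costs at most a factor 2 in the bound on [others a].
    Either a long chain remains, or [others a] has bounded size. *)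
Theorem balanced_of_chains (R : realType) (C : nat) (eps : R) : 0 < eps <= 1 / 2 ->
  exists N : nat,
  forall (V : finType) (lt : rel V) (m M : nat) (a : 'I_m -> V) (b : 'I_M -> V),
  (forall i j, lt (a i) (a j) = (i < j)%N) ->
  (forall i j, lt (b i) (b j) = (i < j)%N) ->
  (forall v i, lt v (a i) -> v \in codom a) ->
  (forall j, b j \notin codom a) ->
  (forall v j, v \notin codom a -> lt v (b j) -> v \in codom b) ->
  (forall i j, lt (a i) (b j) -> (i <= j)%N) ->
  linexts lt != set0 -> (0 < M)%N ->
  (N <= m)%N -> (#|V| <= C * m)%N -> (#|others a| <= C * M)%N ->
  exists u v, balanced_pair lt eps u v.
Proof.
move=> e02; have [M0 [N1 large]] := balanced_of_long_chain C e02.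
have [N2 small] := balanced_of_few_others (2 * C * M0) e02.
exists (N1 + N2 + 2)%N => V lt m M a b lta ltb ida ba idb ab LE0 M0' Nm Vm oM.
have mV : (m <= #|V|)%N.
  by rewrite -[X in (X <= _)%N]card_ord -(card_codom (chain_inj lta)) max_card.
pose M1 := minn M (3 * m %/ 4).
have M1M : (M1 <= M)%N by apply: geq_minl.
have oM1 : (#|others a| <= 2 * C * M1)%N.
  rewrite /M1 /minn; case: ifP => _; first by nia.
  rewrite (card_others lta); apply: leq_trans (leq_subr _ _) (leq_trans Vm _).
  have : (m <= 2 * (3 * m %/ 4))%N by lia.
  by move=> /(leq_mul (leqnn C)); rewrite mulnA [(C * 2)%N]mulnC.
pose b' := b \o widen_ord M1M.
have [MM1|M1M0] := leqP M0 M1.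
  apply: (large V lt m M1 a b') => //.
  - by move=> i j; rewrite /= ltb.
  - by move=> j; apply: ba.
  - move=> v j va vb; have /codomP[k vk] := idb _ _ va vb.
    move: vb; rewrite vk ltb /= => kj.
    have kM1 : (k < M1)%N by apply: ltn_trans kj _.
    by apply/codomP; exists (Ordinal kM1); rewrite /b' /=; congr b; apply: val_inj.
  - by move=> i j /ab.
  - lia.
  - by rewrite MM1 geq_minr.
apply: (small V lt m a (b (Ordinal M0'))) => //.
- by rewrite ltb ltnn.
- move=> v va; apply/negP => vb; have /codomP[k vk] := idb _ _ va vb.
  by move: vb; rewrite vk ltb.
- by move=> i /ab.
- lia.
- by apply: leq_trans oM1 _; rewrite leq_mul2l ltnW ?orbT.
Qed.

(** * Down-closed rows of convex sets *)

Local Open Scope nat_scope.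

Section Geometry.
Variable d : nat.
Local Notation T := (d.-tupleprod nat).
Implicit Types (x y z v : T) (k h : 'I_d) (Q : seq T).

Lemma le_tupleP x y : reflect (forall i, tnth x i <= tnth y i) (x <= y)%O.
Proof. by rewrite leEtprod; apply: (iffP forallP) => le i; have := le i; rewrite leEnat. Qed.

Definition shift x k (t : nat) : T := [tuple tnth x i + (i == k) * t | i < d].

Lemma tnth_shift x k t i : tnth (shift x k t) i = tnth x i + (i == k) * t.
Proof. by rewrite tnth_mktuple. Qed.

Lemma shift0 x k : shift x k 0 = x.
Proof. by apply: eq_from_tnth => i; rewrite tnth_shift muln0 addn0. Qed.

Lemma shiftD x k s t : shift (shift x k s) k t = shift x k (s + t).
Proof. by apply: eq_from_tnth => i; rewrite !tnth_shift; lia. Qed.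

Lemma shift_le x k s t : (shift x k s <= shift x k t)%O = (s <= t).
Proof.
apply/le_tupleP/idP => [/(_ k)|st i]; rewrite !tnth_shift ?eqxx; first by lia.
by rewrite leq_add2l leq_mul2l st orbT.
Qed.

Lemma le_shift x k t : (x <= shift x k t)%O.
Proof. by rewrite -{1}(shift0 x k) shift_le. Qed.

Lemma shift_inj x k : injective (shift x k).
Proof.
move=> s t e; apply/eqP; rewrite eqn_leq -!(shift_le x k) e.
by rewrite !lexx.
Qed.

Definition height x : nat := \sum_i tnth x i.
Definition offset k x : nat := \sum_(i | i != k) tnth x i.

Lemma height_le x y : (x <= y)%O -> height x <= height y.
Proof. by move=> /le_tupleP xy; apply: leq_sum. Qed.

Lemma sum_eq_le (P : pred 'I_d) (f g : 'I_d -> nat) : (forall i, P i -> f i <= g i) ->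
  \sum_(i | P i) g i <= \sum_(i | P i) f i -> forall i, P i -> f i = g i.
Proof.
move=> fg le i Pi; apply/eqP; rewrite eqn_leq fg //=.
move: le; rewrite (bigD1 i) //= [X in _ <= X](bigD1 i) //= => le.
rewrite -(leq_add2r (\sum_(j | P j && (j != i)) f j)); apply: leq_trans le.
by rewrite leq_add2l; apply: leq_sum => j /andP[/fg].
Qed.

Lemma height_lt x y : (x < y)%O -> height x < height y.
Proof.
rewrite lt_neqAle => /andP[nxy xy]; rewrite ltnNge; apply: contra nxy => le; apply/eqP.
by apply: eq_from_tnth => i; apply: (@sum_eq_le predT) => // j _; apply/le_tupleP.
Qed.

Definition convex Q := forall x y z, x \in Q -> z \in Q -> (x <= y)%O -> (y <= z)%O -> y \in Q.

Definition narrow (w : nat) Q := forall s, uniq s -> {subset s <= Q} ->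
  {in s &, forall x y, (x <= y)%O -> x = y} -> size s <= w.

Lemma narrow_sub w Q Q' : {subset Q' <= Q} -> narrow w Q -> narrow w Q'.
Proof. by move=> sub nQ s us sQ; apply: nQ => // x /sQ/sub. Qed.

(** The empty row is allowed and starts the search in [row_length] for the point where down-closure
    fails. *)
Definition ideal_row Q x k (m : nat) : Prop :=
  (forall t, t < m -> shift x k t \in Q) /\
  (forall v t, v \in Q -> t < m -> (v <= shift x k t)%O -> exists2 s, s < m & v = shift x k s).

Definition minimals Q : seq T := [seq z <- Q | all (fun v => ~~ (v < z)%O) Q].

Lemma minimalsP Q z : reflect (z \in Q /\ forall v, v \in Q -> (v <= z)%O -> v = z) (z \in minimals Q).
Proof.
rewrite mem_filter andbC; apply: (iffP andP) => -[zQ].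
  by move=> /allP min; split=> // v vQ; rewrite le_eqVlt (negbTE (min _ vQ)) orbF => /eqP.
move=> min; split => //; apply/allP => v vQ; apply/negP => vz.
by have := vz; rewrite (min _ vQ (ltW vz)) ltxx.
Qed.

Lemma minimal_below Q x : x \in Q -> exists2 z, z \in minimals Q & (z <= x)%O.
Proof.
have [n] := ubnP (height x); elim: n x => // n IH x xn xQ.
have [xm|nxm] := boolP (x \in minimals Q); first by exists x.
move: nxm; rewrite mem_filter xQ andbT => /allPn[v vQ]; rewrite negbK => vx.
have [|z zm zv] := IH v _ vQ; first by have := height_lt vx; lia.
by exists z => //; apply: le_trans zv (ltW vx).
Qed.

Lemma size_minimals w Q : uniq Q -> narrow w Q -> size (minimals Q) <= w.
Proof.
move=> uQ nQ; apply: nQ; first exact: filter_uniq.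
  by move=> z /minimalsP[].
by move=> z z' /minimalsP[zQ _] /minimalsP[_ min] /min; apply.
Qed.

(** The induction parameter of [row_length]; a minimal [z] does not count itself, so it is less than
    the number of minimal elements. *)
Definition lower_minimals Q k z : nat := count (fun z' => offset k z' < offset k z) (minimals Q).

(* If the row of [z] stops being down-closed, some other minimal element lies   *)
(* below its next point, and the rest of the row can be translated onto it.     *)
Lemma row_length Q m k z L : convex Q ->
  (forall x m', ideal_row Q x k m' -> m' <= m) -> z \in minimals Q -> shift z k L \in Q ->
  L < (lower_minimals Q k z).+1 * m.
Proof.
move=> cQ bound; have [n] := ubnP (lower_minimals Q k z); elim: n z L => // n IH z L zn zm LQ.
have [zQ zmin] := minimalsP _ _ zm.
have inQ t : t <= L -> shift z k t \in Q.
  by move=> tL; apply: cQ zQ LQ (le_shift _ _ _) _; rewrite shift_le.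
have [Lid|nLid] := pselect (ideal_row Q z k L.+1).
  by have := bound _ _ Lid; rewrite mulSn; lia.
have [i [iL iid niid]] : exists i, [/\ i <= L, ideal_row Q z k i & ~ ideal_row Q z k i.+1].
  have id0 : ideal_row Q z k 0 by split.
  elim: {LQ inQ} L nLid => [|L IHL] nid; first by exists 0.
  have [idL|/IHL[i [iL ? ?]]] := pselect (ideal_row Q z k L.+1); first by exists L.+1.
  by exists i; split => //; apply: leqW.
have im := bound _ _ iid.
have [v [vQ vi vrow]] : exists v, [/\ v \in Q, (v <= shift z k i)%O & forall s, s <= i -> v <> shift z k s].
  apply: contrapT => nex; apply: niid; split=> [t ti|v t vQ ti vt]; first by apply: inQ; lia.
  apply: contrapT => nv; apply: nex; exists v; split => //.
    by apply: le_trans vt _; rewrite shift_le -ltnS.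
  by move=> s si vs; apply: nv; exists s.
have [z' zm' zv] := minimal_below vQ.
have [zQ' zmin'] := minimalsP _ _ zm'.
have zle j : tnth z' j <= tnth z j + (j == k) * i.
  by rewrite -tnth_shift; apply/le_tupleP/(le_trans zv).
(* Otherwise [z'] and [z] differ at most in coordinate [k], so they agree by minimality, and [v]
   lies on the row. *)
have off : offset k z' < offset k z.
  rewrite ltnNge; apply/negP => le.
  have eqz j : j != k -> tnth z' j = tnth z j.
    apply: (@sum_eq_le (fun j => j != k)) => // {}j jk.
    by have := zle j; rewrite (negbTE jk) addn0.
  have zz : z' = z.
    have [le'|le'] := leqP (tnth z' k) (tnth z k).
      by apply: zmin => //; apply/le_tupleP => j; have [->//|/eqz->] := eqVneq j k.
    apply/esym/zmin' => //; apply/le_tupleP => j.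
    by have [->|/eqz->//] := eqVneq j k; apply: ltnW.
  move: zv; rewrite zz => zv; apply: (vrow (tnth v k - tnth z k)).
    have := le_tupleP _ _ vi k; rewrite tnth_shift eqxx; lia.
  apply: eq_from_tnth => j; rewrite tnth_shift.
  have := le_tupleP _ _ vi j; have := le_tupleP _ _ zv j; rewrite tnth_shift.
  by have [->|] := eqVneq j k; lia.
have low : lower_minimals Q k z' < lower_minimals Q k z.
  rewrite /lower_minimals; set p := fun _ => _; set q := fun _ => _.
  have pq : subpred p q by move=> u; rewrite /p /q => /ltn_trans; apply.
  rewrite -!size_filter.
  have -> : [seq u <- minimals Q | p u] = [seq u <- [seq u <- minimals Q | q u] | p u].
    by rewrite -filter_predI; apply: eq_filter => u /=; case: (boolP (p u)) => // /pq ->.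
  rewrite size_filter -[X in _ < X](count_predC p) -[X in X < _]addn0 ltn_add2l -has_count.
  apply/hasP; exists z'; first by rewrite mem_filter zm' andbT.
  by rewrite /= /p ltnn.
have : L - i < (lower_minimals Q k z').+1 * m.
  apply: IH => //; first by lia.
  apply: cQ zQ' LQ (le_shift _ _ _) _; apply/le_tupleP => j; rewrite !tnth_shift.
  have := zle j; case: (j == k); rewrite ?mul1n ?mul0n ?addn0 // => le.
  by rewrite -{2}(subnKC iL) addnA leq_add2r.
have : (lower_minimals Q k z').+1 * m + m <= (lower_minimals Q k z).+1 * m.
  by rewrite -mulSnr leq_mul2r ltnS low orbT.
by lia.
Qed.

(* Elements with the same coordinate sum form an antichain.                     *)
Lemma size_le_ideal_rows w Q m : uniq Q -> convex Q -> narrow w Q ->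
  (forall x k m', ideal_row Q x k m' -> m' <= m) ->
  size Q <= w * w * (d * (w * m)).+1.
Proof.
move=> uQ cQ nQ bound; pose D := d * (w * m).
have mw := size_minimals uQ nQ.
(* Each [x] lies above some minimal [z], by at most [w * m] in every coordinate ([row_length]). This
   gives at most [w] choices of [z] and [D + 1] of the height. *)
pose c z j x := (z <= x)%O && (height x == height z + j).
have cover x : x \in Q -> 1 <= \sum_(z <- minimals Q) \sum_(j < D.+1) c z j x.
  move=> xQ; have [z zm zx] := minimal_below xQ.
  have [zQ zmin] := minimalsP _ _ zm.
  have coord k : tnth x k <= tnth z k + w * m.
    have le := le_tupleP _ _ zx.
    have : tnth x k - tnth z k < (lower_minimals Q k z).+1 * m.
      apply: row_length => //; first by move=> y m'; apply: bound.
      apply: cQ zQ xQ (le_shift _ _ _) _; apply/le_tupleP => j; rewrite tnth_shift.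
      by case: eqP => [->|_]; rewrite ?mul1n ?mul0n ?addn0 ?subnKC.
    have : (lower_minimals Q k z).+1 <= w.
      apply: leq_trans mw; rewrite /lower_minimals.
      rewrite -(count_predC (fun z' => offset k z' < offset k z) (minimals Q)) -addn1 leq_add2l.
      by rewrite -has_count; apply/hasP; exists z; rewrite //= ltnn.
    by move=> /(leq_mul (leqnn m)); rewrite ![m * _]mulnC; lia.
  have hx : height x - height z <= D.
    rewrite leq_subLR /D -[X in X * _]card_ord -sum_nat_const -big_split /=.
    exact: leq_sum.
  rewrite (big_rem z) //= (bigD1 (Ordinal (hx : height x - height z < D.+1))) //=.
  by rewrite /c zx /= subnKC ?eqxx ?height_le.
have small z j : \sum_(x <- Q) c z j x <= w.
  have -> : \sum_(x <- Q) c z j x = size [seq x <- Q | c z j x].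
    by rewrite size_filter -sum1_count [RHS]big_mkcond; apply: eq_bigr => x _; case: (c z j x).
  apply: nQ; first exact: filter_uniq.
    by move=> x; rewrite mem_filter => /andP[].
  move=> x y; rewrite !mem_filter => /andP[/andP[_ /eqP hx] _] /andP[/andP[_ /eqP hy] _].
  by rewrite le_eqVlt => /orP[/eqP//|/height_lt]; rewrite hx hy ltnn.
apply: (@leq_trans (\sum_(x <- Q) \sum_(z <- minimals Q) \sum_(j < D.+1) c z j x)).
  by rewrite -sum1_size big_seq [X in _ <= X]big_seq; apply: leq_sum.
rewrite exchange_big /=; apply: (@leq_trans (\sum_(z <- minimals Q) \sum_(j < D.+1) w)).
  by apply: leq_sum => z _; rewrite exchange_big /=; apply: leq_sum => j _; apply: small.
rewrite sum_nat_const card_ord big_const_seq count_predT iter_addn_0 mulnC.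
by apply: leq_trans (leq_mul mw (leqnn _)) _; rewrite [_ * w]mulnC mulnA.
Qed.

End Geometry.

(** * A longest row and a row of its complement *)

Section TwoRows.
Variable d : nat.
Local Notation T := (d.-tupleprod nat).
Implicit Types (x y z v : T) (k h : 'I_d) (Q : seq T).

Lemma exists_max_ideal_row Q : uniq Q -> Q != [::] -> 0 < d ->
  exists x k m, [/\ 0 < m, ideal_row Q x k m &
    forall x' k' m', ideal_row Q x' k' m' -> m' <= m].
Proof.
move=> uQ Q0 d0; pose k0 := Ordinal d0.
have [x xQ] : exists x, x \in Q by case: Q Q0 {uQ} => // x Q _; exists x; rewrite mem_head.
have [z zm _] := minimal_below xQ; have [zQ zmin] := minimalsP _ _ zm.
pose p m := `[< exists x k, ideal_row Q x k m >].
have p1 : p 1.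
  apply/asboolP; exists z, k0; split=> [t|v t vQ]; rewrite ltnS leqn0 => /eqP ->; rewrite shift0 //.
  by move=> /(zmin _ vQ) ->; exists 0; rewrite ?shift0.
have pub m : p m -> m <= size Q.
  move=> /asboolP[y [k [inQ _]]]; rewrite -(size_iota 0 m) -(size_map (shift y k)).
  apply: uniq_leq_size; first by rewrite map_inj_uniq ?iota_uniq //; apply: shift_inj.
  by move=> v /mapP[t]; rewrite mem_iota add0n => /andP[_ tm] ->; apply: inQ.
have ex : exists m, p m by exists 1.
case: (ex_maxnP ex pub) => m /asboolP[y [k yk]] mmax.
exists y, k, m; split=> //; first exact: mmax.
by move=> x' k' m' id; apply: mmax; apply/asboolP; exists x', k'.
Qed.

Lemma shift_lt x k s t : (shift x k s < shift x k t)%O = (s < t).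
Proof. by rewrite lt_leAnge !shift_le -ltnNge andb_idl // => /ltnW. Qed.

Section Rows.
Variables (P Y : seq T) (x y : T) (k h : 'I_d) (m n : nat).
Hypotheses (convP : convex P) (m0 : 0 < m).
Hypothesis rowA : ideal_row P x k m.
Hypothesis maxA : ~ ideal_row P x k m.+1.
Hypothesis YE : forall v, v \in Y <-> v \in P /\ forall t, t < m -> v <> shift x k t.
Hypothesis rowB : ideal_row Y y h n.

(** The removed row is down-closed, so no element of [Y] lies below a point of it. *)
Lemma complement_convex : convex Y.
Proof.
move=> u v w /YE[uP uA] /YE[wP wA] uv vw; apply/YE; split; first exact: convP uv vw.
move=> t tm vt; have ut : (u <= shift x k t)%O by rewrite -vt.
by have [s sm us] := rowA.2 _ _ uP tm ut; apply: uA us.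
Qed.

Lemma next_not_minimal : shift x k m \in P ->
  exists v, [/\ v \in Y, (v <= shift x k m)%O & v <> shift x k m].
Proof.
move=> tP; apply: contrapT => nex; apply: maxA; split=> [t|v t vP].
  by rewrite ltnS leq_eqVlt => /orP[/eqP ->//|]; apply: rowA.1.
rewrite ltnS leq_eqVlt => /orP[/eqP -> vt|tm vt]; last first.
  by have [s sm ->] := rowA.2 _ _ vP tm vt; exists s => //; apply: ltnW.
have [->|nv] := pselect (v = shift x k m); first by exists m.
have [vY|nvY] := pselect (v \in Y); first by case: nex; exists v.
apply: contrapT => nrow; apply: nvY; apply/YE; split=> // s sm vs; apply: nrow.
by exists s => //; apply: ltnW.
Qed.

(** The next point of the first row can only be the end of the second. It is not its start, since
    some element of [Y] lies below it. If the second row continued in a direction [h] other than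
    [k], then [shift x h 1] would lie on it, contrary to the [k]-th coordinates; in direction [k],
    the point before would belong to the first row. *)
Lemma next_position j : j < n -> shift y h j = shift x k m -> 0 < j /\ j.+1 = n.
Proof.
move=> jn jt; have bY t : t < n -> shift y h t \in Y by apply: rowB.1.
have tP : shift x k m \in P by rewrite -jt; have /YE[] := bY _ jn.
have j0 : 0 < j.
  have [v [vY vt nvt]] := next_not_minimal tP.
  have vj : (v <= shift y h j)%O by rewrite jt.
  have [s sn vs] := rowB.2 _ _ vY jn vj.
  rewrite lt0n; apply/eqP => j0; move: vj; rewrite vs shift_le j0 leqn0 => /eqP s0.
  by apply: nvt; rewrite vs s0 -j0.
split=> //; apply/eqP; rewrite eqn_leq jn leqNgt; apply/negP => jn1.
have b1Y := bY _ jn1; have [b1P _] := iffLR (YE _) b1Y.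
have xP : x \in P by rewrite -(shift0 x k); apply: rowA.1.
have [hk|hk] := eqVneq h k.
  have /YE[_ /(_ m.-1)] := bY j.-1 (leq_ltn_trans (leq_pred _) jn); apply; first by rewrite prednK.
  apply: eq_from_tnth => i; have := congr1 (fun v => tnth v i) jt; rewrite !tnth_shift hk.
  by case: (i == k); rewrite ?mul1n ?mul0n //; lia.
have xh1 : (shift x h 1 <= shift y h j.+1)%O.
  by rewrite -[j.+1]addn1 -shiftD jt; apply/le_tupleP => i; rewrite !tnth_shift leq_add2r leq_addr.
have xhP : shift x h 1 \in P by apply: convP xP b1P (le_shift _ _ _) xh1.
have xhY : shift x h 1 \in Y.
  apply/YE; split=> // t tm /(congr1 (fun v => tnth v h)); rewrite !tnth_shift eqxx (negbTE hk); lia.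
have [s sn xs] := rowB.2 _ _ xhY jn1 xh1.
have := congr1 (fun v => tnth v k) xs; have := congr1 (fun v => tnth v k) jt.
rewrite !tnth_shift eqxx eq_sym (negbTE hk); lia.
Qed.

(** Induction on [i]: one step back from point [j] in direction [k] leads to an element [v] of [P].
    It is not on the first row, since point [j] would then lie on that row or be its next point. So
    [v] is an earlier point of the second row. *)
Lemma rows_le i j : i < m -> j < n ->
  (forall j', j' <= j -> shift y h j' <> shift x k m) ->
  (shift x k i <= shift y h j)%O -> i <= j.
Proof.
elim: i j => // i IH j im jn nt ij.
have bY : shift y h j \in Y by apply: rowB.1.
have [bP bA] := iffLR (YE _) bY.
(* The subtraction does not truncate, as point [j] lies above point [i.+1] of the first row. *)
pose v : T := [tuple tnth (shift y h j) l - (l == k) | l < d].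
have vE l : tnth v l = tnth (shift y h j) l - (l == k) by rewrite tnth_mktuple.
have le l := le_tupleP _ _ ij l.
have bv : shift y h j = shift v k 1.
  apply: eq_from_tnth => l; rewrite [RHS]tnth_shift vE muln1.
  have := le l; rewrite [tnth (shift x k _) l]tnth_shift.
  by case: (l == k); rewrite ?mul1n ?subn0 ?addn0 // => h1; rewrite subnK //; apply: leq_trans h1; rewrite addnS.
have av : (shift x k i <= v)%O.
  apply/le_tupleP => l; rewrite vE; have := le l; rewrite !tnth_shift.
  by case: (l == k); rewrite ?mul1n ?mul0n ?subn0 // addnS => h1; rewrite subn1 -ltnS (leq_trans h1) // leqSpred.
have vb : (v <= shift y h j)%O by rewrite bv le_shift.
have vP : v \in P by apply: convP (rowA.1 _ (ltnW im)) bP av vb.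
have [[t tm vt]|nA] := pselect (exists2 t, t < m & v = shift x k t).
  move: (bv); rewrite vt shiftD addn1 => bt.
  by move: tm; rewrite leq_eqVlt => /orP[/eqP tm|tm]; [case: (nt j (leqnn _)); rewrite bt tm | case: (bA _ tm)].
have vY : v \in Y by apply/YE; split=> // t tm vt; apply: nA; exists t.
have [s sn vs] := rowB.2 _ _ vY jn vb.
have sj : s < j by rewrite -(shift_lt y h) -vs bv -{1}(shift0 v k) shift_lt.
apply: leq_ltn_trans (sj); apply: IH => //; [exact: ltnW| |by rewrite -vs].
by move=> j' j's; apply: nt; apply: leq_trans j's (ltnW sj).
Qed.

End Rows.
End TwoRows.

(** * Application to finite convex sets *)

Local Open Scope ring_scope.

(** Sort by [f], with ties broken by the enumeration; [key] encodes this lexicographic order. *)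
Lemma linexts_neq0 (V : finType) (lt : rel V) (f : V -> nat) :
  (forall u v, lt u v -> (f u < f v)%N) -> linexts lt != set0.
Proof.
move=> ltf; pose key u := (f u * #|V| + enum_rank u)%N.
have key_lt u v : (f u < f v)%N -> (key u < key v)%N.
  move=> fuv; apply: leq_trans (leq_addr _ _).
  by apply: leq_trans (leq_mul fuv (leqnn _)); rewrite mulSn /key addnC ltn_add2r ltn_ord.
have key_inj u v : key u = key v -> u = v.
  move=> kuv; have [fuv|fvu|fuv] := ltngtP (f u) (f v).
  - by have := key_lt _ _ fuv; rewrite kuv ltnn.
  - by have := key_lt _ _ fvu; rewrite kuv ltnn.
  - by move: kuv; rewrite /key fuv => /addnI/val_inj/enum_rank_inj.
apply/set0Pn; exists [ffun uv => (key uv.1 < key uv.2)%N]; apply/linextP; split.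
- by move=> u; rewrite ffunE ltnn.
- by move=> u v z; rewrite !ffunE; apply: ltn_trans.
- by move=> u v; rewrite !ffunE /= -neq_ltn; apply: contra => /eqP/key_inj ->.
- by move=> u v /ltf /key_lt; rewrite ffunE.
Qed.

Section ConvexSubset.
Variables (d : nat) (P : {fset d.-tupleprod nat}).
Local Notation T := (d.-tupleprod nat).

Definition induced_lt : rel P := fun u v => (val u < val v)%O.

Lemma balance_gt (R : realType) (eps : R) (u v : P) :
  balanced_pair induced_lt eps u v -> 1 / 2 - eps < balance P R.
Proof.
move=> [uv puv pvu]; apply: lt_le_trans (_ : balance_pair R u v <= _).
  by rewrite /balance_pair lt_min; apply/andP; split.
exact: (@le_bigmax_cond _ _ _ 0 (u, v) (fun xy : P * P => xy.1 != xy.2)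
  (fun xy => balance_pair R xy.1 xy.2) uv).
Qed.

Lemma convex_of_order_convex : {subset P <= @posvec d} -> order_convex (@posvec d) P -> convex P.
Proof.
move=> posP cP x y z xP zP; rewrite le_eqVlt => /orP[/eqP <- //|xy].
rewrite le_eqVlt => /orP[/eqP -> //|yz]; have yD : posvec y.
  apply/forallP => i; have /forallP/(_ i) := posP _ xP.
  by move=> /leq_trans; apply; apply/le_tupleP/ltW.
exact: cP xP zP yD xy yz.
Qed.

Lemma narrow_of_width w : (width P <= w)%N -> narrow w P.
Proof.
move=> wP s us sP anti; pose A := [set v : P | val v \in s].
have Aanti : antichain A.
  apply/forallP => u; apply/implyP => uA; apply/forallP => v; apply/implyP => vA.
  apply/implyP => uv; move: uA vA; rewrite !inE => us' vs'.
  by apply/negP => /orP[/(anti _ _ us' vs')|/(anti _ _ vs' us')] e; case/negP: uv; apply/eqP/val_inj.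
have <- : #|A| = size s.
  rewrite cardE -(size_map val); apply/eqP; rewrite -uniq_size_uniq //.
    by rewrite map_inj_uniq ?enum_uniq //; apply: val_inj.
  move=> x; apply/idP/mapP => [xs|[u]]; last by rewrite mem_enum inE => us' ->.
  by exists [` sP _ xs]%fset; rewrite // mem_enum inE.
by apply: leq_trans wP; apply: leq_bigmax_cond.
Qed.

Lemma exists_incomparable : (2 <= width P)%N -> exists u v : P, (val u >< val v)%O.
Proof.
move=> w2; apply: contrapT => nex; move: w2; rewrite ltnNge => /negP; apply.
apply/bigmax_leqP => A /forallP anti; rewrite leqNgt; apply/negP => /card_gt1P[u [v [uA vA uv]]].
apply: nex; exists u, v; move: (anti u); rewrite uA => /forallP/(_ v).
by rewrite vA uv.
Qed.

End ConvexSubset.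

Theorem theorem1p8 (R : realType) (d w : nat) (hd : (0 < d)%N) (hw : (0 < w)%N)
    (eps : R) (heps : 0 < eps) :
  exists N : nat, forall P : {fset d.-tupleprod nat},
    {subset P <= @posvec d} ->
    order_convex (@posvec d) P ->
    (2 <= width P <= w)%N ->
    (N < #|` P|)%N ->
    balance P R > 1 / 2 - eps.
Proof.
(* The results on chains assume a tolerance of at most 1/2, and a smaller tolerance gives a stronger
   bound. *)
pose e := Num.min eps (1 / 2); have e02 : 0 < e <= 1 / 2.
  by rewrite lt_min heps ge_min lexx orbT andbT; apply/andP; split => //; lra.
pose C := (w * w * (d * w).+1)%N.
have C0 : (0 < C)%N by rewrite !muln_gt0 hw.
have sizeC m : (0 < m)%N -> (w * w * (d * (w * m)).+1 <= C * m)%N.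
  move=> m0; rewrite /C -[leqRHS]mulnA leq_mul2l; apply/orP; right.
  by rewrite mulSn [(d * _)%N]mulnA -add1n leq_add2r.
have [N0 bal] := balanced_of_chains (2 * C) e02.
exists (C * N0)%N => P posP cP /andP[w2 wP] NP.
have convP := convex_of_order_convex posP cP.
have nP := narrow_of_width wP.
pose Q : seq (d.-tupleprod nat) := P.
have uQ : uniq Q by apply: fset_uniq.
have sQ : size Q = #|` P| by [].
have Q0 : Q != [::] by rewrite -size_eq0 sQ; lia.
have [x [k [m [m0 rowA maxA]]]] := exists_max_ideal_row uQ Q0 hd.
have Qm : (size Q <= C * m)%N.
  by apply: leq_trans (size_le_ideal_rows uQ convP nP maxA) (sizeC _ m0).
have Nm : (N0 <= m)%N.
  by apply: ltnW; rewrite -(ltn_pmul2l C0); apply: leq_trans NP _; rewrite -sQ.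
pose Y := [seq v <- Q | all (fun t => v != shift x k t) (iota 0 m)].
have YE v : v \in Y <-> v \in Q /\ forall t, (t < m)%N -> v <> shift x k t.
  rewrite mem_filter; split=> [/andP[/allP vA vQ]|[-> vA]].
    by split=> // t tm; apply/eqP/vA; rewrite mem_iota.
  by rewrite andbT; apply/allP => t; rewrite mem_iota => /andP[_ tm]; apply/eqP/vA.
have uY : uniq Y by apply: filter_uniq.
have YQ : {subset Y <= Q} by move=> v /YE[].
have Y0 : Y != [::].
  apply/eqP => Ynil; have [u [v]] := exists_incomparable w2.
  have inA (z : P) : exists t, val z = shift x k t.
    apply: contrapT => nz; have : val z \in Y; last by rewrite Ynil.
    by apply/YE; split=> [|t _ zt]; [apply: valP | apply: nz; exists t].
  have [s ->] := inA u; have [t ->] := inA v.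
  by rewrite /Order.comparable !shift_le leq_total.
have maxA' : ~ ideal_row Q x k m.+1 by move=> /maxA; rewrite ltnn.
have convY := complement_convex convP rowA YE.
have [y [h [n [n0 rowB maxB]]]] := exists_max_ideal_row uY Y0 hd.
have Yn : (size Y <= C * n)%N.
  by apply: leq_trans (size_le_ideal_rows uY convY (narrow_sub YQ nP) maxB) (sizeC _ n0).
(* The last point of the second row is dropped, as it may be the next point of the first, which
   [rows_le] excludes. A single point can stay, since [next_position] gives [0 < j]. As
   [n <= 2 * M], the constant at most doubles. *)
pose M := maxn 1 n.-1.
have Mn : (M <= n)%N by rewrite /M; lia.
have nM : (n <= 2 * M)%N by rewrite /M; lia.
have aP (i : 'I_m) : shift x k i \in P by apply: rowA.1.
have bY (j : 'I_M) : shift y h j \in Y by apply: rowB.1; apply: leq_trans (ltn_ord j) Mn.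
have bP (j : 'I_M) : shift y h j \in P by apply: YQ.
pose a (i : 'I_m) : P := [` aP i]%fset.
pose b (j : 'I_M) : P := [` bP j]%fset.
have codom_a (v : P) : (v \in codom a) = (val v \notin Y).
  apply/codomP/idP => [[i ->]|nvY].
    by apply/negP => /YE[_ /(_ i)]; apply; rewrite ?ltn_ord.
  apply: contrapT => nva; case/negP: nvY; apply/YE; split; first exact: valP.
  by move=> t tm vt; apply: nva; exists (Ordinal tm); apply: val_inj.
have [|||||||||||u [v buv]] := bal P (@induced_lt d P) m M a b.
- by move=> i j; rewrite /induced_lt /= shift_lt.
- by move=> i j; rewrite /induced_lt /= shift_lt.
- move=> v i /ltW vi; rewrite codom_a; apply/negP => /YE[vQ vA].
  by have [s sm vs] := rowA.2 _ _ vQ (ltn_ord i) vi; apply: vA vs.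
- by move=> j; rewrite codom_a negbK; apply: bY.
- move=> v j; rewrite codom_a negbK => vY vj.
  have [s sn vs] := rowB.2 _ _ vY (leq_trans (ltn_ord j) Mn) (ltW vj).
  have sj : (s < j)%N by rewrite -(shift_lt y h) -vs.
  apply/codomP; exists (Ordinal (ltn_trans sj (ltn_ord j))).
  by apply: val_inj; rewrite /= vs.
- move=> i j /ltW ij; have jn : (j < n)%N := leq_trans (ltn_ord j) Mn.
  apply: (rows_le convP rowA YE rowB (ltn_ord i) jn _ ij) => j' j'j jt.
  have [j'0 j'n] := next_position convP m0 rowA maxA' YE rowB (leq_ltn_trans j'j jn) jt.
  have : (j < maxn 1 n.-1)%N := ltn_ord j; lia.
- by apply: (@linexts_neq0 _ _ (fun u => height (val u))) => u v; apply: height_lt.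
- by rewrite /M; lia.
- by [].
- by rewrite -cardfE -sQ (leq_trans Qm) // leq_mul2r leq_pmull ?orbT.
- apply: (@leq_trans (size Y)); last first.
    by apply: leq_trans Yn _; rewrite [(2 * C)%N]mulnC -mulnA leq_mul2l nM orbT.
  rewrite cardE -(size_map val); apply: uniq_leq_size.
    by rewrite map_inj_uniq ?enum_uniq //; apply: val_inj.
  by move=> v /mapP[u]; rewrite mem_enum inE codom_a negbK => uY' ->.
apply: le_lt_trans (balance_gt buv); rewrite lerD2l lerN2 ge_min lexx //.
Qed.
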